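(* Let $q\ge4$ be an even integer, and let $F$ be a nonzero random variable (self-adjoint element) in the $q$-th Wigner chaos associated with the free Brownian motion $S$. Then $F$ cannot have a (centered) free Poisson distribution; that is, there is no $\lambda>0$ such that the law of $F$ is the centered free Poisson distribution with rate $\lambda$.
   Context: Probability space. $(\mathscr{A},\varphi)$ is a tracial $W^*$-probability space: $\mathscr{A}$ is a von Neumann algebra and $\varphi$ is a unital linear functional on $\mathscr{A}$ that is weakly continuous, positive, faithful ($\varphi(XX^* )=0$ implies $X=0$) and tracial ($\varphi(XY)=\varphi(YX)$). Self-adjoint elements of $\mathscr{A}$ are called random variables. The law (distribution) of a random variable $X$ is the unique Borel probability measure $\mu_X$ on $\mathbb{R}$ with $\varphi(X^m)=\int x^m\,\mu_X(dx)$ for all integers $m\ge0$. Free Poisson law. For $\lambda>0$ the free Poisson distribution $P(\lambda)$ with rate $\lambda$ is the probability measure on $\mathbb{R}$ equal to $(1-\lambda)\delta_0+\widetilde\nu$ if $\lambda\in(0,1]$ and to $\widetilde\nu$ if $\lambda>1$, where $\widetilde\nu(dx)=(2\pi x)^{-1}\sqrt{4\lambda-(x-1-\lambda)^2}\,dx$ on $x\in\big((1-\sqrt\lambda)^2,(1+\sqrt\lambda)^2\big)$. Equivalently, all its free cumulants of order $m\ge1$ are equal to $\lambda$. The centered free Poisson distribution with rate $\lambda$ is the law of $Z(\lambda)=X_\lambda-\lambda 1$, where $X_\lambda$ has law $P(\lambda)$ and $1$ is the unit. Free Brownian motion. For $t>0$, $S(0,t)$ is the semicircular law $(2\pi t)^{-1}\sqrt{4t-x^2}\,dx$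 on $|x|<2\sqrt t$. A free Brownian motion $S$ on $(\mathscr{A},\varphi)$ consists of a filtration $\{\mathscr{A}_t:t\ge0\}$ of von Neumann subalgebras of $\mathscr{A}$ ($\mathscr{A}_u\subset\mathscr{A}_t$ for $u<t$) and self-adjoint operators $\{S(t):t\ge0\}$ such that $S(t)\in\mathscr{A}_t$ has law $S(0,t)$ and, for $0\le u<t$, $S(t)-S(u)$ is freely independent of $\mathscr{A}_u$ and has law $S(0,t-u)$. Wigner integrals. $L^2(\mathbb{R}_+^q)$ is the space of complex-valued square-integrable functions on $\mathbb{R}_+^q$ (Lebesgue measure). The adjoint of $f$ is $f^*(t_1,\dots,t_q)=\overline{f(t_q,\dots,t_1)}$, and $f$ is mirror symmetric if $f=f^*$ almost everywhere. For $f=\prod_{i=1}^q\mathbf 1_{(a_i,b_i)}(t_i)$ with pairwise disjoint intervals, $I(f)=(S(b_1)-S(a_1))\cdots(S(b_q)-S(a_q))$; $I$ is extended linearly to finite linear combinations of such functions and then to all of $L^2(\mathbb{R}_+^q)$ by density, using the isometry $\varphi(I(f)^*I(g))=\int_{\mathbb{R}_+^q}\overline{f}\,g$. It is standard that $I(f)$ is a bounded operator in $\mathscr{A}$, and $I(f)$ is self-adjoint if and only if $f$ is mirror symmetric. The set $\{I(f):f\in L^2(\mathbb{R}_+^q)\}$ is the $q$-th Wigner chaos associated with $S$. *)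

(* Defs.v *)
From HB Require Import structures.
From mathcomp Require Import all_boot all_order all_algebra.
From mathcomp Require Import complex.
From mathcomp Require Import all_classical all_reals all_analysis.
From mathcomp Require Import measurable_realfun.

Set Implicit Arguments.
Unset Strict Implicit.
Unset Printing Implicit Defensive.
Import Order.TTheory GRing.Theory Num.Theory.
Import numFieldNormedType.Exports.
Local Open Scope classical_set_scope.
Local Open Scope ring_scope.
Local Open Scope complex_scope.

Section lebesgue_cons.
Context (R : realType) (n : nat).
Variable m : {sigma_finite_measure set (n.-tuple R) -> \bar R}.

Definition pair_cons (p : measurableTypeR R * n.-tuple R) : n.+1.-tuple R :=
  [tuple of p.1 :: p.2].

Let measurable_pair_cons : measurable_fun setT pair_cons.
Proof. by apply: (measurable_cons (T2 := R)); [exact: measurable_fst|exact: measurable_snd]. Qed.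

Definition lebesgue_cons : set (n.+1.-tuple R) -> \bar R :=
  pushforward (lebesgue_measure \x m)%E pair_cons.

Let lebesgue_cons0 : lebesgue_cons set0 = 0%E.
Proof. by rewrite /lebesgue_cons /pushforward preimage_set0 measure0. Qed.

Let lebesgue_cons_ge0 A : (0 <= lebesgue_cons A)%E.
Proof. exact: measure_ge0. Qed.

Let lebesgue_cons_sigma_additive : semi_sigma_additive lebesgue_cons.
Proof.
move=> F mF tF mUF; rewrite /lebesgue_cons /pushforward preimage_bigcup.
apply: measure_semi_sigma_additive.
- by move=> k; rewrite -[X in measurable X]setTI; exact: measurable_pair_cons.
- apply/trivIsetP => /= i j _ _ ij; rewrite -preimage_setI.
  by move/trivIsetP : tF => /(_ _ _ _ _ ij) ->//; rewrite preimage_set0.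
- rewrite -preimage_bigcup -[X in measurable X]setTI.
  exact: measurable_pair_cons.
Qed.

HB.instance Definition _ := isMeasure.Build _ _ _ lebesgue_cons
  lebesgue_cons0 lebesgue_cons_ge0 lebesgue_cons_sigma_additive.

Let lebesgue_cons_sigma_finite : sigma_finite setT lebesgue_cons.
Proof.
have /sigma_finiteP[F [UF ndF Foo]] := sigma_finiteT m.
have /sigma_finiteP[G [UG ndG Goo]] := sigma_finiteT (@lebesgue_measure R).
pose E k := G k `*` F k.
have UE : \bigcup_k E k = setT.
  apply/seteqP; split => // -[x t] _.
  have [i _ Gx] : (\bigcup_k G k) x by rewrite -UG.
  have [j _ Ft] : (\bigcup_k F k) t by rewrite -UF.
  exists (maxn i j) => //; split => /=.
    by move: x Gx; exact/subsetPset/ndG/leq_maxl.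
  by move: t Ft; exact/subsetPset/ndF/leq_maxr.
pose uncons (t : n.+1.-tuple R) : measurableTypeR R * n.-tuple R :=
  (thead t, [tuple of behead t]).
have unconsK (p : measurableTypeR R * n.-tuple R) : uncons (pair_cons p) = p.
  by case: p => x t; rewrite /uncons /pair_cons; congr pair; apply/val_inj.
have muncons : measurable_fun setT uncons.
  apply/measurable_fun_pairP; split => /=.
    exact: (measurable_tnth (ord0 : 'I_n.+1)).
  exact: measurable_behead.
exists (fun k => uncons @^-1` E k).
  by rewrite -preimage_bigcup UE preimage_setT.
move=> k; have [mFk Fkoo] := Foo k; have [mGk Gkoo] := Goo k; split.
  by rewrite -[X in measurable X]setTI; apply: muncons => //; exact: measurableX.
rewrite /lebesgue_cons /pushforward -comp_preimage.
rewrite (_ : uncons \o pair_cons = id); last exact/funext.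
rewrite [X in (X < _)%E](_ : _ = lebesgue_measure (G k) * m (F k))%E.
  by rewrite lte_mul_pinfty// ge0_fin_numE.
exact: product_measure1E.
Qed.

HB.instance Definition _ := Measure_isSigmaFinite.Build _ _ _ lebesgue_cons
  lebesgue_cons_sigma_finite.

End lebesgue_cons.

Fixpoint lebesgue_tuple (R : realType) (n : nat) :
    {sigma_finite_measure set (n.-tuple R) -> \bar R} :=
  if n is k.+1 then lebesgue_cons (lebesgue_tuple R k)
  else \d_([tuple] : 0.-tuple R).

Section density_measure.
Context (R : realType) (g : measurableTypeR R -> R).
Hypotheses (mg : measurable_fun setT g) (g0 : forall x, 0 <= g x).

(* The proof arguments let the measure structure below be inferred. *)
Definition density_measure of (measurable_fun setT g) & (forall x, 0 <= g x) :
    set (measurableTypeR R) -> \bar R :=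
  fun A => (\int[lebesgue_measure]_(x in A) (g x)%:E)%E.

Local Notation mu := (density_measure mg g0).

Let mu0 : mu set0 = 0%E. Proof. by rewrite /density_measure integral_set0. Qed.

Let mu_ge0 A : (0 <= mu A)%E.
Proof. by apply: integral_ge0 => x _; rewrite lee_fin. Qed.

Let mu_sigma_additive : semi_sigma_additive mu.
Proof.
move=> /= F mF tF mUF; rewrite /density_measure; apply: cvg_toP.
  apply: ereal_nondecreasing_is_cvgn => m n mn.
  by apply: lee_sum_nneg_natr => // k _ _; exact: mu_ge0.
rewrite ge0_integral_bigcup//=.
- apply: (@measurable_funTS _ _ _ _ _ (EFin \o g)).
  exact: measurableT_comp.
- by move=> x _; rewrite lee_fin.
Qed.

HB.instance Definition _ := isMeasure.Build _ _ _ mu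
  mu0 mu_ge0 mu_sigma_additive.

End density_measure.

Section laws.
Context (R : realType).

(* For t <= 0 the support is empty and this is the null measure. *)
Definition semicircular_pdf (t x : R) : R :=
  if `|x| < 2 * Num.sqrt t
  then (2 * pi * t)^-1 * Num.sqrt (4 * t - x ^+ 2) else 0.

Lemma semicircular_pdf_ge0 t x : 0 <= semicircular_pdf t x.
Proof.
rewrite /semicircular_pdf; case: ifPn => // xt; rewrite mulr_ge0 ?sqrtr_ge0//.
rewrite invr_ge0 !mulr_ge0 ?pi_ge0//; have [//|t0] := leP 0 t.
by move: xt; rewrite ltr0_sqrtr// mulr0 ltNge normr_ge0.
Qed.

Lemma measurable_semicircular_pdf t : measurable_fun setT (semicircular_pdf t).
Proof.
apply: measurable_fun_ifT => //.
  by apply: measurable_fun_ltr => //; exact: measurableT_comp.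
apply: measurable_funM => //.
apply: (measurableT_comp (continuous_measurable_fun (@sqrt_continuous R))).
by apply: measurable_funB => //; exact: measurable_funX.
Qed.

Definition semicircular (t : R) : {measure set (measurableTypeR R) -> \bar R} :=
  density_measure (measurable_semicircular_pdf t) (semicircular_pdf_ge0 t).

Definition free_poisson_pdf (lambda x : R) : R :=
  if (1 - Num.sqrt lambda) ^+ 2 < x < (1 + Num.sqrt lambda) ^+ 2
  then (2 * pi * x)^-1 * Num.sqrt (4 * lambda - (x - 1 - lambda) ^+ 2) else 0.

Lemma free_poisson_pdf_ge0 lambda x : 0 <= free_poisson_pdf lambda x.
Proof.
rewrite /free_poisson_pdf; case: ifPn => // /andP[lx _].
rewrite mulr_ge0 ?sqrtr_ge0// invr_ge0 !mulr_ge0 ?pi_ge0//.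
by rewrite (le_trans (sqr_ge0 _) (ltW lx)).
Qed.

Lemma measurable_free_poisson_pdf lambda :
  measurable_fun setT (free_poisson_pdf lambda).
Proof.
pose g x : R :=
  if (1 - Num.sqrt lambda) ^+ 2 < x < (1 + Num.sqrt lambda) ^+ 2
  then (2 * pi)^-1 * x `^ (-1) * Num.sqrt (4 * lambda - (x - 1 - lambda) ^+ 2)
  else 0.
rewrite (_ : free_poisson_pdf lambda = g); last first.
  apply/funext => x; rewrite /free_poisson_pdf /g.
  case: ifPn => // /andP[lx _]; congr (_ * _).
  by rewrite invfM powR_inv1// (le_trans (sqr_ge0 _) (ltW lx)).
apply: measurable_fun_ifT => //.
  by apply: measurable_and; exact: measurable_fun_ltr.
apply: measurable_funM.
  by apply: measurable_funM => //; exact: measurable_powR.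
apply: (measurableT_comp (continuous_measurable_fun (@sqrt_continuous R))).
apply: measurable_funB => //; apply: measurable_funX.
by do 2 apply: measurable_funB => //.
Qed.

Lemma free_poisson_atom_ge0 (lambda : R) :
  0 <= (if lambda <= 1 then 1 - lambda else 0).
Proof. by case: ifPn => //; rewrite subr_ge0. Qed.

Definition free_poisson (lambda : R) :
    {measure set (measurableTypeR R) -> \bar R} :=
  measure_add
    (mscale (NngNum (free_poisson_atom_ge0 lambda))
       (@dirac _ (measurableTypeR R) 0 R))
    (density_measure (measurable_free_poisson_pdf lambda)
       (free_poisson_pdf_ge0 lambda)).

Let measurable_shift (lambda : R) :
  measurable_fun setT (fun x : measurableTypeR R => x - lambda : measurableTypeR R).
Proof. by apply: (@measurable_funB _ R). Qed.

(* The image of P(lambda) under x |-> x - lambda, that is the law of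
   X - lambda 1 when X has law P(lambda). *)
Definition centered_free_poisson (lambda : R) :
    {measure set (measurableTypeR R) -> \bar R} :=
  measure_function_pushforward__canonical__measure_function_Measure
    (free_poisson lambda) (measurable_shift lambda).

End laws.

Section operators.
Context (R : realType) (H : completeNormedModType R[i]).
Variable dot : {dot H for Num.conj}.
Implicit Types (A B : set (H -> H)) (X Y : H -> H) (phi : (H -> H) -> R[i]).

(* [dot] is linear in its first argument. *)
Definition hilbert_norm := forall x : H, `|x| ^+ 2 = dot x x.

Definition bounded_operator X :=
  linear X /\ exists M : R[i], forall x, `|X x| <= M * `|x|.

Definition is_adjoint X Y := forall x y, dot (X x) y = dot x (Y y).

(* The adjoint, when it exists. *)
Definition adjoint X : H -> H := xget (fun=> 0) [set Y : H -> H | is_adjoint X Y].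

Definition selfadjoint X := is_adjoint X X.

Definition commutant A : set (H -> H) :=
  [set X | bounded_operator X /\ forall Y, A Y -> X \o Y = Y \o X].

Record von_neumann_algebra A : Prop := {
  vna_adjoint : forall X, A X -> exists2 Y, A Y & is_adjoint X Y;
  vna_bicommutant : commutant (commutant A) = A }.

(* Weak continuity is continuity for the sigma-weak (ultraweak) topology, which
   is generated by the functionals X |-> \sum_n <X xi_n, eta_n> with xi and eta
   square-summable. *)
Definition square_summable (xi : nat -> H) :=
  cvgn (series (fun n => complex.Re (`|xi n| ^+ 2))).

Definition sigma_weak_functional (w : (H -> H) -> R[i]) :=
  exists xi eta : nat -> H,
    [/\ square_summable xi, square_summable eta &
        forall X, bounded_operator X ->
          series (fun n => dot (X (xi n)) (eta n) : R[i]^o) @ \oo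
            --> (w X : R[i]^o)].

Definition weakly_continuous A phi :=
  forall X, A X -> forall e : R[i], 0 < e ->
  exists (n : nat) (w : 'I_n -> (H -> H) -> R[i]) (d : R[i]),
    [/\ forall i, sigma_weak_functional (w i), 0 < d &
        forall Y, A Y -> (forall i, `|w i Y - w i X| < d) ->
          `|phi Y - phi X| < e].

Record tracial_state A phi : Prop := {
  state_unital : phi idfun = 1;
  state_linear : forall (a : R[i]) X Y, A X -> A Y ->
    phi (a \*: X \+ Y) = a * phi X + phi Y;
  state_weakly_continuous : weakly_continuous A phi;
  state_positive : forall X, A X -> 0 <= phi (X \o adjoint X);
  state_faithful : forall X, A X -> phi (X \o adjoint X) = 0 -> X = (fun=> 0);
  state_tracial : forall X Y, A X -> A Y -> phi (X \o Y) = phi (Y \o X) }.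

(* The case m = 0 forces mu to have total mass phi 1 = 1. *)
Definition has_law phi X (mu : {measure set (measurableTypeR R) -> \bar R}) :=
  forall m : nat,
    mu.-integrable setT (fun x => (x ^+ m)%:E) /\
    phi (iter m X) = (Rintegral mu setT (fun x => x ^+ m))%:C.

Definition generated_algebra X : set (H -> H) :=
  [set Y | exists p : {poly R[i]},
     Y = fun x => \sum_(i < size p) p`_i *: iter i X x].

Definition opprod n (X : nat -> H -> H) : H -> H :=
  \big[@comp H H H/idfun]_(k < n) X k.

Definition freely_independent phi (I : Type) (B : I -> set (H -> H)) :=
  forall (n : nat) (i : nat -> I) (X : nat -> H -> H), (0 < n)%N ->
    (forall k, (k.+1 < n)%N -> i k <> i k.+1) ->
    (forall k, (k < n)%N -> B (i k) (X k) /\ phi (X k) = 0) ->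
    phi (opprod n X) = 0.

Definition free_from phi X B :=
  freely_independent phi (fun b : bool => if b then generated_algebra X else B).

Record free_brownian_motion A phi (At : R -> set (H -> H)) (S : R -> H -> H) :
    Prop := {
  fbm_subalgebra : forall t, 0 <= t -> von_neumann_algebra (At t) /\ At t `<=` A;
  fbm_filtration : forall u t, 0 <= u -> u < t -> At u `<=` At t;
  fbm_adapted : forall t, 0 <= t -> At t (S t) /\ selfadjoint (S t);
  (* the degenerate law S(0, 0) *)
  fbm_start : S 0 = (fun=> 0);
  fbm_law : forall t, 0 < t -> has_law phi (S t) (semicircular t);
  fbm_free : forall u t, 0 <= u -> u < t -> free_from phi (S t \- S u) (At u);
  fbm_increment : forall u t, 0 <= u -> u < t ->
    has_law phi (S t \- S u) (semicircular (t - u)) }.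

End operators.

Section wigner.
Context (R : realType) (H : completeNormedModType R[i]).
Variable dot : {dot H for Num.conj}.
Variables (A : set (H -> H)) (phi : (H -> H) -> R[i]) (S : R -> H -> H).
Variable q : nat.

Definition orthant : set (q.-tuple R) := [set t | forall i, 0 <= tnth t i].

Definition sqnormL2 (f : q.-tuple R -> R[i]) : \bar R :=
  (\int[lebesgue_tuple R q]_(t in orthant)
     (complex.Re (f t) ^+ 2 + complex.Im (f t) ^+ 2)%:E)%E.

Definition inL2 (f : q.-tuple R -> R[i]) :=
  [/\ measurable_fun orthant (fun t => complex.Re (f t)),
      measurable_fun orthant (fun t => complex.Im (f t)) &
      (sqnormL2 f < +oo)%E].

(* A box is given by the pairs (a_i, b_i) of endpoints of its sides, and a step
   function by a list of boxes with complex coefficients. *)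
Definition offdiagonal_box (J : q.-tuple (R * R)) :=
  (forall i, 0 <= (tnth J i).1 < (tnth J i).2) /\
  (forall i j, i != j ->
     `](tnth J i).1, (tnth J i).2[ `&` `](tnth J j).1, (tnth J j).2[ = set0).

Definition box_indicator (J : q.-tuple (R * R)) (t : q.-tuple R) : R :=
  \prod_(i < q) \1_(`](tnth J i).1, (tnth J i).2[) (tnth t i).

Definition box_integral (J : q.-tuple (R * R)) : H -> H :=
  \big[@comp H H H/idfun]_(i < q) (S (tnth J i).2 \- S (tnth J i).1).

Definition step := seq (R[i] * q.-tuple (R * R)).

Definition step_fun (s : step) (t : q.-tuple R) : R[i] :=
  \sum_(p <- s) p.1 * (box_indicator p.2 t)%:C.

Definition step_integral (s : step) : H -> H :=
  fun x => \sum_(p <- s) p.1 *: box_integral p.2 x.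

(* The graph of I: by the isometry, X = I(f) exactly when the step integrals of
   step functions converging to f in L^2 converge to X in L^2(phi). *)
Definition is_wigner_integral (f : q.-tuple R -> R[i]) (X : H -> H) :=
  A X /\ exists s : nat -> step,
    [/\ forall n p, p \in s n -> offdiagonal_box p.2,
        (fun n => sqnormL2 (fun t => f t - step_fun (s n) t)) @ \oo --> 0%E &
        (fun n => let D := X \- step_integral (s n) in
           phi (adjoint dot D \o D) : R[i]^o) @ \oo --> (0 : R[i]^o)].

Definition wigner_chaos : set (H -> H) :=
  [set X | exists2 f, inL2 f & is_wigner_integral f X].

End wigner.

(* Main.v *)
From HB Require Import structures.
Require Import Defs.
From mathcomp Require Import all_boot all_order all_algebra.
From mathcomp Require Import complex ring lra.
From mathcomp Require Import all_classical all_reals all_analysis.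
From mathcomp Require Import measurable_realfun.
Set Implicit Arguments.
Unset Strict Implicit.
Unset Printing Implicit Defensive.
Import Order.TTheory GRing.Theory Num.Theory.
Import numFieldNormedType.Exports.
Local Open Scope classical_set_scope.
Local Open Scope ring_scope.

(** Let [lambda] be the rate and let [f_n], elements of the q-th chaos, converge
    to [F] in L^2.  The moments phi(F^2) = phi(F^3) = lambda and
    phi(F^4) = lambda + 2 lambda^2 give [K := F^2 - lambda - F] squared norm
    lambda^2.  The component [f_n (x) f_n] of order 2q of [f_n^2] satisfies
    <F^2, f_n (x) f_n> = <F, f_n>^2 and ||f_n (x) f_n|| = ||f_n||^2, hence
    converges to [K].  So [F^2] has no component of order 2, which says
    ||X F||^2 = phi(X^2) ||F||^2 for every increment [X] of the Brownian motion.
    The component of order q + 1 of [X f_n] has this squared norm in the limit,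
    hence converges to [X F]; thus [X F] has no component of order q - 1, [F] is
    orthogonal to every product of q increments, and phi(F^2) = 0. *)

(** * Wick words and chaos *)

(** Chaos elements are handled as combinations of Wick words in increments, not through kernels.
    Left multiplication by a letter creates or annihilates only at the left end of a word, so the
    inner product of two words pairs their letters position by position, without symmetrization;
    this is why the tensor of [f_n] with itself has norm exactly that of [f_n] squared. A product of
    words differs from their concatenation by shorter words, and orthogonality between orders
    discards these, so no contraction is ever computed. Two obstacles shape the rest. Multiplication
    is not continuous in L^2, so [F * F] and [x * F] are only paired with fixed elements, and strong
    convergence is recovered from equality of norms. The letters may be overlapping increments, so
    freeness does not apply to a word directly: all endpoints are refined to one partition, whose
    latest increment is split off by freeness. *)

Section numClosedField_limits.
Context (C : numClosedFieldType).
Implicit Types (u v : nat -> C^o) (a b : C^o).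

Lemma closed_cvgD u v a b : u @ \oo --> a -> v @ \oo --> b ->
  (fun n => u n + v n : C^o) @ \oo --> (a + b : C^o).
Proof. exact: (@cvgD C C^o). Qed.

Lemma closed_cvgB u v a b : u @ \oo --> a -> v @ \oo --> b ->
  (fun n => u n - v n : C^o) @ \oo --> (a - b : C^o).
Proof. exact: (@cvgB C C^o). Qed.

Lemma closed_cvgM u v a b : u @ \oo --> a -> v @ \oo --> b ->
  (fun n => (u n : C) * (v n : C) : C^o) @ \oo --> ((a : C) * (b : C) : C^o).
Proof. exact: (@cvgM C). Qed.

Lemma closed_cvg_unique u a b : u @ \oo --> a -> u @ \oo --> b -> a = b.
Proof. exact: (@cvg_unique _ (@norm_hausdorff C C^o)). Qed.

End numClosedField_limits.

Section wick.
Context (C : numClosedFieldType) (AA : algType C) (phi : {scalar AA}).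
Implicit Types (x y z : AA) (u v w : seq AA).

(* Normally ordered products: left multiplication by a letter is creation plus
   annihilation, see [mul_wick]. *)
Fixpoint wick_rec w : AA :=
  if w is x :: w1 then
    x * wick_rec w1 - (if w1 is y :: w2 then phi (x * y) *: wick_rec w2 else 0)
  else 1.

(** Locked so that simplification never unfolds a word; [wick_nil] and [wick_cons] are the
    interface. *)
Definition wick := locked wick_rec.

Lemma wick_nil : wick [::] = 1. Proof. by rewrite /wick -lock. Qed.

(** The default letter 0 kills the contraction term when [w] is empty, so one formula covers words
    of every length. *)
Lemma wick_cons x w :
  wick (x :: w) = x * wick w - phi (x * head 0 w) *: wick (behead w).
Proof.
rewrite /wick -lock; case: w => [|y w] //.
by rewrite [LHS]/= [head _ _]/= mulr0 (linear0 phi) scale0r.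
Qed.

Lemma mul_wick x w :
  x * wick w = wick (x :: w) + phi (x * head 0 w) *: wick (behead w).
Proof. by rewrite wick_cons subrK. Qed.

Lemma wick1 x : wick [:: x] = x.
Proof. by rewrite wick_cons wick_nil /= mulr0 (linear0 phi) scale0r subr0 mulr1. Qed.

Lemma wick_linear u x c y v :
  wick (u ++ (x + c *: y) :: v) = wick (u ++ x :: v) + c *: wick (u ++ y :: v).
Proof.
have [n] := ubnP (size u); elim: n u => // n IH [|a [|b u]] /= un.
- rewrite !wick_cons !mulrDl (linearD phi) -!scalerAl (linearZ_LR phi) /=.
  by rewrite scalerBr scalerDl scalerA opprD addrACA.
- rewrite 3!(wick_cons a) /= !(IH [::])//= !mulrDr (linearD phi) -!scalerAr.
  by rewrite (linearZ_LR phi) /= scalerBr scalerDl scalerA opprD addrACA.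
- rewrite 3!(wick_cons a) /= (IH (b :: u))// IH//; last by rewrite -ltnS ltnW.
  by rewrite mulrDr scalerBr scalerDr opprD addrACA -scalerAr !scalerA mulrC.
Qed.

(** Contractions are nested, so any contraction between [u] and [v] would have to include the pair
    of letters that meet at the cut. *)
Lemma wick_cat u v :
  phi (last 0 u * head 0 v) = 0 -> wick (u ++ v) = wick u * wick v.
Proof.
have [n] := ubnP (size u); elim: n u => // n IH [|a [|b u]] /= un uv.
- by rewrite wick_nil mul1r.
- by rewrite wick1 mul_wick uv scale0r addr0.
- rewrite 2!(wick_cons a) /= (IH (b :: u))// mulrBl mulrA -scalerAl.
  congr (_ - _ *: _); case: u un uv => [|c u] un uv.
    by rewrite wick_nil mul1r.
  by rewrite IH// -ltnS ltnW.
Qed.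

End wick.

(** * Inner products and products of Wick words *)

Section semicircular_family.
Context (C : numClosedFieldType) (AA : algType C) (phi : {scalar AA}).
Variable star : AA -> AA.
Hypotheses (starK : involutive star) (starD : {morph star : x y / x + y}).
Hypothesis starZ : forall a x, star (a *: x) = a^* *: star x.
Hypothesis starM : forall x y, star (x * y) = star y * star x.
Hypothesis phi_star : forall x, phi (star x) = (phi x)^*.
Hypothesis phi_ge0 : forall x, 0 <= phi (star x * x).
Hypothesis phi_tracial : forall x y, phi (x * y) = phi (y * x).
Hypothesis phi1 : phi 1 = 1.
Implicit Types (x y z : AA) (u v w : seq AA).

Local Notation wick := (wick phi).

Definition ip x y := phi (star y * x).

Lemma star1 : star 1 = 1.
Proof. by rewrite -[LHS]mulr1 -{2}(starK 1) -starM mulr1 starK. Qed.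

Lemma starN x : star (- x) = - star x.
Proof. by rewrite -scaleN1r starZ rmorphN rmorph1 scaleN1r. Qed.

Lemma ipDl x y z : ip (x + y) z = ip x z + ip y z.
Proof. by rewrite /ip mulrDr (linearD phi). Qed.
Lemma ipZl a x z : ip (a *: x) z = a * ip x z.
Proof. by rewrite /ip -scalerAr (linearZ_LR phi). Qed.
Lemma ipNl x z : ip (- x) z = - ip x z.
Proof. by rewrite /ip mulrN (linearN phi). Qed.
Lemma ipBl x y z : ip (x - y) z = ip x z - ip y z.
Proof. by rewrite ipDl ipNl. Qed.
Lemma ipC x y : ip y x = (ip x y)^*.
Proof. by rewrite /ip -phi_star starM starK. Qed.
Lemma ipDr x y z : ip x (y + z) = ip x y + ip x z.
Proof. by rewrite /ip starD mulrDl (linearD phi). Qed.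
Lemma ipZr a x z : ip x (a *: z) = a^* * ip x z.
Proof. by rewrite /ip starZ -scalerAl (linearZ_LR phi). Qed.
Lemma ipNr x z : ip x (- z) = - ip x z.
Proof. by rewrite /ip starN mulNr (linearN phi). Qed.
Lemma ipBr x y z : ip x (y - z) = ip x y - ip x z.
Proof. by rewrite ipDr ipNr. Qed.
Lemma ip_mull x y z : ip (x * y) z = ip y (star x * z).
Proof. by rewrite /ip starM starK mulrA. Qed.
Lemma ip_mulr x y z : ip (x * y) z = ip x (z * star y).
Proof. by rewrite /ip starM starK mulrA phi_tracial mulrA. Qed.
Lemma ip1r x : ip x 1 = phi x. Proof. by rewrite /ip star1 mul1r. Qed.

Lemma ip_suml (I : Type) (r : seq I) (f : I -> AA) z :
  ip (\sum_(i <- r) f i) z = \sum_(i <- r) ip (f i) z.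
Proof. by rewrite /ip mulr_sumr (linear_sum phi). Qed.

Lemma ip_sumr (I : Type) (r : seq I) (f : I -> AA) z :
  ip z (\sum_(i <- r) f i) = \sum_(i <- r) ip z (f i).
Proof.
rewrite ipC ip_suml rmorph_sum; apply: eq_bigr => i _.
by rewrite [in RHS]ipC.
Qed.

Lemma cauchy_schwarz x y : `|ip x y| ^+ 2 <= ip x x * ip y y.
Proof.
have ge0 z : 0 <= ip z z by exact: phi_ge0.
have key c : 0 <= ip x x - c^* * ip x y - c * (ip x y)^* + `|c| ^+ 2 * ip y y.
  have := ge0 (x - c *: y).
  rewrite ipBl !ipBr !ipZl !ipZr -(ipC x y) normCK opprB addrA.
  rewrite (_ : _ - _ =
    ip x x - c^* * ip x y - c * ip y x + c * c^* * ip y y)//.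
  by ring.
(* The form may be degenerate. If [ip y y = 0] and [ip x y] is nonzero, the chosen [c] turns the
   right-hand side of [key] into [- (ip x x + 2)], which is negative. Otherwise [c] is the minimizer
   [ip x y / ip y y]. *)
have [y0|y0] := eqVneq (ip y y) 0.
  have xr : (ip x x)^* = ip x x by exact/CrealP/ger0_real/ge0.
  have [-> |xy0] := eqVneq (ip x y) 0; first by rewrite normr0 expr0n mulr_ge0.
  have nz : (ip x y)^* != 0 by rewrite conjC_eq0.
  have E : ((ip x x + 1) / (ip x y)^*)^* = (ip x x + 1) / ip x y.
    by rewrite fmorph_div /= conjCK rmorphD rmorph1 /= xr.
  have := key ((ip x x + 1) / (ip x y)^*).
  rewrite E y0 mulr0 addr0 !divfK// [X in 0 <= X](_ : _ = - (ip x x + 2)).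
    by rewrite oppr_ge0 lt_geF// ltr_wpDl.
  by ring.
have y1 : 0 < ip y y by rewrite lt0r y0 ge0.
have yr : (ip y y)^* = ip y y by exact/CrealP/ger0_real/ge0.
have E : (ip x y / ip y y)^* = (ip x y)^* / ip y y by rewrite fmorph_div /= yr.
have := key (ip x y / ip y y).
rewrite normCK E -(pmulr_rge0 _ y1) normCK.
rewrite (_ : _ * (_ + _) = ip x x * ip y y - ip x y * (ip x y)^*).
  by rewrite subr_ge0.
by field.
Qed.

Definition letters (P : AA -> Prop) w := forall x, x \in w -> P x.

(** The inner product of elementary tensors in the full Fock space: a single pairing, with no sum
    over permutations. *)
Fixpoint gram u v : C :=
  match u, v with
  | [::], [::] => 1
  | x :: u', y :: v' => phi (x * y) * gram u' v'
  | _, _ => 0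
  end.

Lemma gram_cat u u' v v' : size u = size u' ->
  gram (u ++ v) (u' ++ v') = gram u u' * gram v v'.
Proof.
elim: u u' => [|x u IH] [|x' u'] //= => [_|[/IH->]]; first by rewrite mul1r.
by rewrite mulrA.
Qed.

Lemma gram_size u v : size u <> size v -> gram u v = 0.
Proof.
elim: u v => [|x u IH] [|y v] //= uv; rewrite IH ?mulr0// => uv'.
by apply: uv; rewrite uv'.
Qed.

Variable P : AA -> Prop.
Hypothesis P_sa : forall x, P x -> star x = x.
Hypothesis P_wick : forall w, w != [::] -> letters P w -> phi (wick w) = 0.

(** The first letter of [v] moves across the inner product and acts on [wick u] by creation and
    annihilation. The vanishing [P_wick] is the only input on the joint law of the letters. *)
Lemma ip_wick u v : letters P u -> letters P v -> ip (wick u) (wick v) = gram u v.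
Proof.
have [n] := ubnP (size v); elim: n v u => // n IH [|x v] u /= vn Pu Pv.
  rewrite wick_nil ip1r; case: u Pu => [|y u] Pu; first by rewrite wick_nil phi1.
  by rewrite P_wick.
have Px : P x by apply: Pv; rewrite mem_head.
have Pv' : letters P v by move=> y yv; apply: Pv; rewrite inE yv orbT.
have Pbv : letters P (behead v) by move=> y /mem_behead /Pv'.
have Pbu : letters P (behead u) by move=> y /mem_behead /Pu.
have Pxu : letters P (x :: u) by move=> y /[!inE] /predU1P[->|/Pu].
have phir : (phi (x * head 0 v))^* = phi (x * head 0 v).
  case: v Pv' {vn Pv Pbv} => [|y v] Pv /=; first by rewrite mulr0 (linear0 phi) conjC0.
  by rewrite -phi_star starM !P_sa// ?phi_tracial//; apply: Pv; rewrite mem_head.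
have sbv : (size (behead v) < n)%N by rewrite size_behead (leq_ltn_trans (leq_pred _)).
rewrite wick_cons ipBr ipZr phir -{1}(P_sa Px) -ip_mull mul_wick ipDl ipZl.
rewrite !IH//.
(* The creation term cancels against the correction in [wick_cons]; the annihilation term is what
   remains. *)
case: u {Pu Pbu Pxu} => [|z u] /=.
  case: v {vn Pv Pv' Pbv phir sbv} => [|y v] /=; first by rewrite mulr0; ring.
  by rewrite mulr0; ring.
rewrite (phi_tracial z x).
by case: v {vn Pv Pv' Pbv phir sbv} => [|y v] /=; rewrite ?mulr0 ?(linear0 phi); ring.
Qed.

Definition chaos_elt (s : seq (C * seq AA)) := \sum_(p <- s) p.1 *: wick p.2.

Definition homogeneous k (s : seq (C * seq AA)) :=
  forall p, p \in s -> size p.2 = k /\ letters P p.2.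

(** Only the order of a remainder is recorded, since remainders are always tested against elements
    homogeneous of order [k]. *)
Definition below k x := exists2 s : seq (C * seq AA), x = chaos_elt s &
  forall p, p \in s -> (size p.2 < k)%N /\ letters P p.2.

Lemma ip_chaos_elt s t k l : homogeneous k s -> homogeneous l t ->
  ip (chaos_elt s) (chaos_elt t) =
  \sum_(p <- s) \sum_(p' <- t) p.1 * p'.1^* * gram p.2 p'.2.
Proof.
move=> hs ht; rewrite ip_suml; apply: eq_big_seq => p ps.
rewrite ip_sumr; apply: eq_big_seq => p' pt.
have [_ ?] := hs _ ps; have [_ ?] := ht _ pt.
by rewrite ipZl ipZr ip_wick// mulrA.
Qed.

Lemma chaos_orthogonal s t k l : homogeneous k s -> homogeneous l t ->
  k != l -> ip (chaos_elt s) (chaos_elt t) = 0.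
Proof.
move=> hs ht kl; rewrite (ip_chaos_elt hs ht).
rewrite big_seq big1// => p ps; rewrite big_seq big1// => p' pt.
have [pk _] := hs _ ps; have [pl _] := ht _ pt.
by rewrite gram_size ?mulr0// pk pl; exact/eqP.
Qed.

Lemma below_orthogonal x t k : below k x -> homogeneous k t ->
  ip x (chaos_elt t) = 0.
Proof.
move=> [s -> hs] ht; rewrite ip_suml big_seq big1// => p ps.
rewrite ip_sumr big_seq big1// => p' pt.
have [pk ?] := hs _ ps; have [pl ?] := ht _ pt.
rewrite ipZl ipZr ip_wick// gram_size ?mulr0// pl.
by apply/eqP; rewrite neq_ltn pk.
Qed.

Lemma belowD k x y : below k x -> below k y -> below k (x + y).
Proof.
move=> [s -> hs] [t -> ht]; exists (s ++ t); first by rewrite /chaos_elt big_cat.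
by move=> p; rewrite mem_cat => /orP[/hs|/ht].
Qed.

Lemma below0 k : below k 0.
Proof. by exists [::]; rewrite // /chaos_elt big_nil. Qed.

Lemma belowZ k a x : below k x -> below k (a *: x).
Proof.
move=> [s -> hs]; exists [seq (a * p.1, p.2) | p <- s].
  rewrite /chaos_elt big_map scaler_sumr; apply: eq_bigr => p _.
  by rewrite scalerA.
by move=> p /mapP[p' /hs hp ->].
Qed.

Lemma below_wick k w : letters P w -> (size w < k)%N -> below k (wick w).
Proof.
move=> Pw wk; exists [:: (1, w)]; first by rewrite /chaos_elt big_seq1 scale1r.
by move=> p /[!inE] /eqP ->.
Qed.

Lemma below_mul k x y : P x -> below k y -> below k.+1 (x * y).
Proof.
move=> Px [s -> hs]; rewrite /chaos_elt mulr_sumr.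
rewrite big_seq; apply: big_ind; [exact: below0|exact: belowD|move=> p ps].
have [pk Pp] := hs _ ps.
rewrite -scalerAr mul_wick; apply: belowZ; apply: belowD.
  by apply: below_wick => // z /[!inE] /predU1P[->|/Pp].
apply/belowZ/below_wick => [z /mem_behead/Pp//|].
by rewrite size_behead ltnS (leq_trans (leq_pred _))// ltnW.
Qed.

(** Concatenation is the leading term of the product, because every annihilation removes two
    letters. *)
Lemma below_wick_mul u v : letters P u -> letters P v ->
  below (size u + size v) (wick u * wick v - wick (u ++ v)).
Proof.
have [n] := ubnP (size u); elim: n u => // n IH [|x u] /= un Pu Pv.
  by rewrite wick_nil mul1r subrr; exact: below0.
have Px : P x by apply: Pu; rewrite mem_head.
have Pu' : letters P u by move=> y yu; apply: Pu; rewrite inE yu orbT.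
have Pbu : letters P (behead u) by move=> y /mem_behead /Pu'.
have -> : wick (x :: u) * wick v - wick (x :: u ++ v) =
  x * (wick u * wick v - wick (u ++ v)) +
  phi (x * head 0 (u ++ v)) *: wick (behead (u ++ v)) -
  phi (x * head 0 u) *: (wick (behead u) * wick v).
  rewrite !wick_cons mulrBl mulrBr -scalerAl !mulrA opprB -!addrA.
  by congr (_ + _); rewrite [LHS]addrC [RHS]addrC addrAC.
apply: belowD; [apply: belowD|].
- by apply: below_mul => //; exact: IH.
- apply/belowZ/below_wick => [y /mem_behead|].
    by rewrite mem_cat => /orP[/Pu'|/Pv].
  by rewrite size_behead size_cat ltnS leq_pred.
rewrite -scaleNr; apply: belowZ.
case: u un Pu Pu' Pbu => [|y u] /= un Pu Pu' Pbu.
  by rewrite wick_nil mul1r; apply: below_wick => //; rewrite add0n.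
rewrite -(subrK (wick (u ++ v)) (wick u * _)); apply: belowD.
  have [s -> hs] := IH u (ltnW un) Pbu Pv.
  exists s => // p /hs [ps Pp]; split => //.
  by rewrite (ltn_trans ps)// !addSn ltnS leqnSn.
apply: below_wick; last by rewrite size_cat !addSn ltnS leqnSn.
by move=> z; rewrite mem_cat => /orP[/Pbu|/Pv].
Qed.

Definition tensor (s t : seq (C * seq AA)) : seq (C * seq AA) :=
  [seq (p.1 * p'.1, p.2 ++ p'.2) | p <- s, p' <- t].

Lemma homogeneous_tensor k l s t : homogeneous k s -> homogeneous l t ->
  homogeneous (k + l) (tensor s t).
Proof.
move=> hs ht p /allpairsP[[p1 p2] /= [/hs [k1 P1] /ht [k2 P2] ->]] /=.
rewrite size_cat k1 k2; split=> // x.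
by rewrite mem_cat => /orP[/P1|/P2].
Qed.

Lemma below_tensor k l s t : homogeneous k s -> homogeneous l t ->
  below (k + l) (chaos_elt s * chaos_elt t - chaos_elt (tensor s t)).
Proof.
move=> hs ht; rewrite /chaos_elt big_allpairs_dep mulr_suml -sumrB.
rewrite big_seq; apply: big_ind; [exact: below0|exact: belowD|move=> p ps].
rewrite mulr_sumr -sumrB big_seq.
apply: big_ind; [exact: below0|exact: belowD|move=> p' pt /=].
have [pk ?] := hs _ ps; have [pl ?] := ht _ pt.
rewrite -scalerAl -scalerAr scalerA -scalerBr; apply: belowZ.
by rewrite -pk -pl; exact: below_wick_mul.
Qed.

Lemma ip_tensor k l s t s' t' :
  homogeneous k s -> homogeneous l t -> homogeneous k s' -> homogeneous l t' ->
  ip (chaos_elt (tensor s t)) (chaos_elt (tensor s' t')) =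
  ip (chaos_elt s) (chaos_elt s') * ip (chaos_elt t) (chaos_elt t').
Proof.
move=> hs ht hs' ht'.
rewrite (ip_chaos_elt (homogeneous_tensor hs ht) (homogeneous_tensor hs' ht')).
rewrite (ip_chaos_elt hs hs') (ip_chaos_elt ht ht').
rewrite big_allpairs_dep mulr_suml; apply: eq_big_seq => p ps.
rewrite mulr_sumr; apply: eq_bigr => r _.
rewrite big_allpairs_dep mulr_suml; apply: eq_big_seq => p' ps'.
rewrite mulr_sumr; apply: eq_bigr => r' _ /=.
have [pk _] := hs _ ps; have [pk' _] := hs' _ ps'.
by rewrite gram_cat ?pk ?pk'// rmorphM /=; ring.
Qed.

(** Against elements of top order [k + l] the product may be replaced by the tensor, whose Gram form
    splits at position [k]. *)
Lemma ip_mul_tensor k l s t s' t' :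
  homogeneous k s -> homogeneous l t -> homogeneous k s' -> homogeneous l t' ->
  ip (chaos_elt s * chaos_elt t) (chaos_elt (tensor s' t')) =
  ip (chaos_elt s) (chaos_elt s') * ip (chaos_elt t) (chaos_elt t').
Proof.
move=> hs ht hs' ht'; rewrite -(ip_tensor hs ht hs' ht').
rewrite -[chaos_elt s * _](subrK (chaos_elt (tensor s t))) ipDl.
by rewrite (below_orthogonal (below_tensor hs ht) (homogeneous_tensor hs' ht')) add0r.
Qed.

(** * Limits in L^2 of elements of a fixed chaos *)

Definition cvg_L2 (z_ : nat -> AA) z :=
  (fun n => ip (z - z_ n) (z - z_ n) : C^o) @ \oo --> (0 : C^o).

Lemma cvg_ipl (z_ : nat -> AA) z y : cvg_L2 z_ z ->
  (fun n => ip (z_ n) y : C^o) @ \oo --> (ip z y : C^o).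
Proof.
move=> zz; apply/cvgrPdist_lt => e e0.
(* Adding 1 keeps the divisor positive when [ip y y] vanishes. *)
have c0 : 0 < ip y y + 1 by rewrite ltr_wpDl ?ltr01//; exact: phi_ge0.
have d0 : 0 < e ^+ 2 / (ip y y + 1) by rewrite divr_gt0// exprn_gt0.
move/cvgrPdist_lt : zz => /(_ _ d0); apply: filterS => n.
rewrite sub0r normrN ger0_norm; last exact: phi_ge0.
rewrite ltr_pdivlMr// => dn.
rewrite -ipBl -(ltr_pXn2r (n := 2))// ?nnegrE ?(ltW e0)//.
apply: le_lt_trans (cauchy_schwarz _ _) (le_lt_trans _ dn).
by rewrite ler_wpM2l ?lerDl ?ler01//; exact: phi_ge0.
Qed.

Lemma cvg_ipr (z_ : nat -> AA) z y : cvg_L2 z_ z ->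
  (fun n => ip y (z_ n) : C^o) @ \oo --> (ip y z : C^o).
Proof.
move=> zz; have /cvgrPdist_lt H := cvg_ipl (y := y) zz.
apply/cvgrPdist_lt => e /H; apply: filterS => n.
by rewrite (ipC z y) (ipC (z_ n) y) -rmorphB /= norm_conjC.
Qed.

Lemma cvg_L2_orthogonal (z_ : nat -> AA) z y : cvg_L2 z_ z ->
  (forall n, ip (z_ n) y = 0) -> ip z y = 0.
Proof.
move=> zz zy; apply: closed_cvg_unique (cvg_ipl (y := y) zz) _.
by under eq_fun do rewrite zy; exact: cvg_cst.
Qed.

Lemma cvg_ip_self (z_ : nat -> AA) z : cvg_L2 z_ z ->
  (fun n => ip (z_ n) (z_ n) : C^o) @ \oo --> (ip z z : C^o).
Proof.
move=> zz.
have -> : (fun n => ip (z_ n) (z_ n) : C^o) =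
  (fun n => ip (z - z_ n) (z - z_ n) - ip z z + ip (z_ n) z + ip z (z_ n) : C^o).
  by apply/funext => n; rewrite ipBl !ipBr; ring.
rewrite [X in _ --> X](_ : _ = 0 - ip z z + ip z z + ip z z :> C^o); last by ring.
exact: (closed_cvgD (closed_cvgD (closed_cvgB zz (@cvg_cst C^o _ _ _ _))
  (cvg_ipl zz)) (cvg_ipr zz)).
Qed.

(** Expand the squared distance. This is the equality case of Cauchy-Schwarz in the limit: a
    component with asymptotically the full norm of [z] must converge to [z]. *)
Lemma cvg_L2_self (z_ : nat -> AA) z :
  (fun n => ip z (z_ n) : C^o) @ \oo --> (ip z z : C^o) ->
  (fun n => ip (z_ n) z : C^o) @ \oo --> (ip z z : C^o) ->
  (fun n => ip (z_ n) (z_ n) : C^o) @ \oo --> (ip z z : C^o) -> cvg_L2 z_ z.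
Proof.
move=> z1 z2 z3; rewrite /cvg_L2.
have -> : (fun n => ip (z - z_ n) (z - z_ n) : C^o) =
  (fun n => ip z z - ip z (z_ n) - ip (z_ n) z + ip (z_ n) (z_ n) : C^o).
  by apply/funext => n; rewrite ipBl !ipBr; ring.
rewrite [X in _ --> X](_ : _ = ip z z - ip z z - ip z z + ip z z :> C^o); last by ring.
exact: (closed_cvgD (closed_cvgB (closed_cvgB (@cvg_cst C^o _ _ _ _) z1) z2) z3).
Qed.

Section chaos_limit.
Variables (q : nat) (s : nat -> seq (C * seq AA)) (F : AA).
Hypothesis hs : forall n, homogeneous q (s n).
Let f_ n := chaos_elt (s n).
Hypothesis sF : cvg_L2 f_ F.

Lemma chaos_limit_orthogonal t k : homogeneous k t -> k != q ->
  ip F (chaos_elt t) = 0.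
Proof.
move=> ht kq; apply: cvg_L2_orthogonal sF _ => n.
by rewrite (chaos_orthogonal (@hs n) ht)// eq_sym.
Qed.

Lemma chaos_limit_mean : (0 < q)%N -> phi F = 0.
Proof.
move=> q0; have h0 : homogeneous 0 [:: (1 : C, [::])] by move=> p /[!inE] /eqP ->.
rewrite -ip1r -[1](_ : chaos_elt [:: (1, [::])] = 1).
  by rewrite (chaos_limit_orthogonal h0)// neq_ltn q0.
by rewrite /chaos_elt big_seq1 scale1r wick_nil.
Qed.

(* The two factors [F] are approximated one after the other, so no bound on the
   operator norms of the approximations is needed. *)
Lemma ip_sqr_tensor t t' : homogeneous q t -> homogeneous q t' ->
  ip (F * F) (chaos_elt (tensor t t')) = ip F (chaos_elt t) * ip F (chaos_elt t').
Proof.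
move=> ht ht'; set G := chaos_elt _.
have step k : ip (f_ k * F) G = ip (f_ k) (chaos_elt t) * ip F (chaos_elt t').
  rewrite ip_mull; apply: closed_cvg_unique (cvg_ipl (y := star (f_ k) * G) sF) _.
  under eq_fun do rewrite -ip_mull (ip_mul_tensor (@hs _) (@hs _) ht ht').
  by apply: closed_cvgM; [exact: cvg_cst|exact: cvg_ipl].
rewrite ip_mulr; apply: closed_cvg_unique (cvg_ipl (y := G * star F) sF) _.
under eq_fun do rewrite -ip_mulr step.
by apply: closed_cvgM; [exact: cvg_ipl|exact: cvg_cst].
Qed.

Lemma ip_mul_letter_tensor x t : P x -> homogeneous q t ->
  ip (x * F) (chaos_elt (tensor [:: (1, [:: x])] t)) =
  ip x x * ip F (chaos_elt t).
Proof.
move=> Px ht; set G := chaos_elt _.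
have hx : homogeneous 1 [:: (1 : C, [:: x])].
  by move=> p /[!inE] /eqP -> /=; split=> // y /[!inE] /eqP ->.
have Ex : chaos_elt [:: (1, [:: x])] = x by rewrite /chaos_elt big_seq1 scale1r wick1.
rewrite ip_mull; apply: closed_cvg_unique (cvg_ipl (y := star x * G) sF) _.
under eq_fun do rewrite -ip_mull -{1}Ex (ip_mul_tensor hx (@hs _) hx ht) Ex.
by apply: closed_cvgM; [exact: cvg_cst|exact: cvg_ipl].
Qed.

Theorem chaos_moments_eq0 (lambda : C) : (2 < q)%N -> star F = F ->
  phi (F ^+ 2) = lambda -> phi (F ^+ 3) = lambda ->
  phi (F ^+ 4) = lambda + 2 * lambda ^+ 2 -> lambda = 0.
Proof.
move=> q2 Fsa m2 m3 m4.
have FF : ip F F = lambda by rewrite /ip Fsa -m2 expr2.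
have lr : lambda^* = lambda by rewrite -FF -ipC.
have h0 : homogeneous 0 [:: (1 : C, [::])] by move=> p /[!inE] /eqP ->.
have E0 : chaos_elt [:: (1, [::])] = 1 by rewrite /chaos_elt big_seq1 scale1r wick_nil.
have F1 : ip F 1 = 0.
  by rewrite -E0 (chaos_limit_orthogonal h0)// neq_ltn (ltn_trans _ q2).
pose t n := tensor (s n) (s n); have ht n := homogeneous_tensor (@hs n) (@hs n).
(* The second and third moments make [K] orthogonal to [1] and to [F]: the terms subtracted are the
   projections of [F * F] on these two. *)
pose K := F * F - lambda *: 1 - F.
have KK : ip K K = lambda ^+ 2.
  have e1 : ip (F * F) (F * F) = lambda + 2 * lambda ^+ 2.
    by rewrite /ip starM Fsa -m4 !exprS expr0 mulr1 !mulrA.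
  have e2 : ip (F * F) F = lambda by rewrite /ip Fsa -m3 !exprS expr0 mulr1 !mulrA.
  have e3 : ip (F * F) 1 = lambda by rewrite ip1r -m2 expr2.
  have e11 : ip 1 1 = 1 by rewrite ip1r phi1.
  rewrite /K !ipBl !ipBr !ipZl !ipZr e1 e2 e3 FF F1 e11 lr.
  rewrite (ipC (F * F) F) e2 (ipC (F * F) 1) e3 (ipC F 1) F1 lr conjC0.
  by ring.
have fF := cvg_ipl (y := F) sF; have Ff := cvg_ipr (y := F) sF.
(* The order [q + q] of the tensor differs from 0 and from [q], so the terms [lambda *: 1] and [F]
   of [K] do not contribute. *)
have KG n : ip K (chaos_elt (t n)) = ip F (f_ n) ^+ 2.
  rewrite /K !ipBl ipZl ip_sqr_tensor// -E0 (chaos_orthogonal h0 (ht n)); last first.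
    by rewrite neq_ltn addn_gt0 (ltn_trans _ q2).
  rewrite (chaos_limit_orthogonal (ht n)); last first.
    by rewrite -[X in _ != X]addn0 eqn_add2l -lt0n (ltn_trans _ q2).
  by rewrite mulr0 !subr0 expr2.
have tK : cvg_L2 (fun n => chaos_elt (t n)) K.
  apply: cvg_L2_self; rewrite KK -FF expr2.
  - by under eq_fun do rewrite KG expr2; apply: closed_cvgM.
  - under eq_fun do rewrite ipC KG expr2 rmorphM /= -ipC.
    by apply: closed_cvgM.
  - under eq_fun do rewrite (ip_tensor (@hs _) (@hs _) (@hs _) (@hs _)).
    by apply: closed_cvgM; exact: cvg_ip_self.
(* The word [x x] has order 2, which for [2 < q] differs from 0, [q] and [q + q]; hence [F * F] is
   orthogonal to [x * x - phi (x * x) *: 1], and traciality rearranges [ip (F * F) (x * x)] into the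
   norm of [x * F]. *)
have xF x : P x -> ip (x * F) (x * F) = ip x x * lambda.
  move=> Px; pose T := [:: (1 : C, [:: x; x])].
  have hT : homogeneous 2 T.
    by move=> p /[!inE] /eqP -> /=; split=> // y /[!inE] /orP[] /eqP ->.
  have ET : chaos_elt T = x * x - phi (x * x) *: 1.
    by rewrite /chaos_elt big_seq1 scale1r wick_cons /= wick1 wick_nil.
  have : ip K (chaos_elt T) = 0.
    apply: cvg_L2_orthogonal tK _ => n; apply: (chaos_orthogonal (ht n) hT).
    by rewrite neq_ltn [X in _ || X](_ : _ = true) ?orbT// (leq_trans q2)// leq_addr.
  rewrite /K !ipBl ipZl (chaos_limit_orthogonal hT); last by rewrite neq_ltn q2.
  rewrite -E0 (chaos_orthogonal h0 hT)// mulr0 !subr0 ET ipBr ipZr ip1r.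
  rewrite -expr2 m2 => /eqP; rewrite subr_eq0 => /eqP.
  rewrite -{3}(P_sa Px) -/(ip x x) -ipC => <-.
  by rewrite /ip !starM Fsa P_sa// -(mulrA F) phi_tracial expr2 !mulrA.
(* By [xF], creation alone already accounts for the whole norm of [x * F], so nothing is left for
   annihilation, which would live in order [q.-1]. *)
have xFw x w : P x -> letters P w -> size w = q.-1 -> ip (x * F) (wick w) = 0.
  move=> Px Pw wq.
  have hx : homogeneous 1 [:: (1 : C, [:: x])].
    by move=> p /[!inE] /eqP -> /=; split=> // y /[!inE] /eqP ->.
  pose c n := chaos_elt (tensor [:: (1, [:: x])] (s n)).
  have Ex : chaos_elt [:: (1, [:: x])] = x by rewrite /chaos_elt big_seq1 scale1r wick1.
  have hc n := homogeneous_tensor hx (@hs n).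
  have cF : cvg_L2 c (x * F).
    have xr : (ip x x)^* = ip x x by rewrite -ipC.
    apply: cvg_L2_self; rewrite xF// -FF.
    - under eq_fun do rewrite ip_mul_letter_tensor//.
      by apply: closed_cvgM => //; exact: cvg_cst.
    - under eq_fun do rewrite ipC ip_mul_letter_tensor// rmorphM /= xr -ipC.
      by apply: closed_cvgM => //; exact: cvg_cst.
    - under eq_fun do rewrite /c (ip_tensor hx (@hs _) hx (@hs _)) Ex.
      by apply: closed_cvgM; [exact: cvg_cst|exact: cvg_ip_self].
  have hw : homogeneous q.-1 [:: (1 : C, w)] by move=> p /[!inE] /eqP ->.
  have Ew : chaos_elt [:: (1, w)] = wick w by rewrite /chaos_elt big_seq1 scale1r.
  rewrite -Ew; apply: cvg_L2_orthogonal cF _ => n; apply: chaos_orthogonal hw _ => //.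
  by rewrite neq_ltn add1n ltnS leq_pred orbT.
have Fw w : letters P w -> size w = q -> ip F (wick w) = 0.
  case: w => [_ q0|x w Pxw wq]; first by move: q2; rewrite -q0.
  have Px : P x by apply: Pxw; rewrite mem_head.
  have Pw : letters P w by move=> y yw; apply: Pxw; rewrite inE yw orbT.
  (* The remaining correction is a word with two letters fewer, to which [F] is orthogonal by
     order. *)
  rewrite wick_cons ipBr ipZr -{1}(P_sa Px) -ip_mull xFw//; last by rewrite -wq.
  have hw : homogeneous (size w).-1 [:: (1 : C, behead w)].
    by move=> p /[!inE] /eqP -> /=; rewrite size_behead; split=> // y /mem_behead/Pw.
  have -> : wick (behead w) = chaos_elt [:: (1, behead w)].
    by rewrite /chaos_elt big_seq1 scale1r.
  rewrite (chaos_limit_orthogonal hw) ?mulr0 ?subr0//.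
  by rewrite -wq neq_ltn ltnS leq_pred.
rewrite -FF; apply: cvg_L2_orthogonal sF _ => n.
rewrite ipC ip_sumr big_seq big1 ?conjC0// => p ps.
by have [pq Pp] := hs ps; rewrite ipZr Fw ?mulr0.
Qed.

End chaos_limit.
End semicircular_family.

(** * Vanishing of Wick words of free increments *)

Section free_extension.
Context (C : numClosedFieldType) (AA : algType C) (phi : {scalar AA}).
Implicit Types (x y z : AA) (u v w : seq AA).
Local Notation wick := (wick phi).

Definition in_factor (Z : AA) (B : AA -> Prop) (b : bool) x :=
  if b then exists p : {poly C}, x = horner_alg Z p else B x.

(** Alternating centered products are encoded as tagged lists, so that the runs of a word can serve
    directly as factors. *)
Definition free_pair (Z : AA) (B : AA -> Prop) :=
  forall l : seq (bool * AA), l != [::] ->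
    sorted (fun a b : bool * AA => a.1 != b.1) l ->
    (forall p, p \in l -> phi p.2 = 0 /\ in_factor Z B p.1 p.2) ->
    phi (\prod_(p <- l) p.2) = 0.

Lemma wick_horner Z n : exists p, wick (nseq n Z) = horner_alg Z p.
Proof.
suff [[p pE] _] : (exists p, wick (nseq n Z) = horner_alg Z p) /\
    exists p, wick (nseq n.+1 Z) = horner_alg Z p by exists p.
elim: n => [|n [[p pE] [r rE]]].
  by split; [exists 1; rewrite wick_nil rmorph1|exists 'X; rewrite wick1 horner_algX].
split; first by exists r.
exists ('X * r - (phi (Z * Z))%:P * p).
rewrite [nseq _ _]/= wick_cons -/(nseq n.+1 Z) rE /= pE.
by rewrite rmorphB !rmorphM /= horner_algX horner_algC mulr_algl.
Qed.

Lemma run_decomposition (w : seq (bool * AA)) : exists rs : seq (bool * seq AA),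
  [/\ w = flatten [seq [seq (r.1, x) | x <- r.2] | r <- rs],
      sorted (fun a b : bool * seq AA => a.1 != b.1) rs &
      forall r, r \in rs -> r.2 != [::]].
Proof.
elim: w => [|[b x] w [[|[b' u] rs] [-> sr hr]]]; first by exists [::].
  by exists [:: (b, [:: x])]; split=> // r /[!inE] /eqP ->.
have [<-|bb] := eqVneq b' b.
  exists ((b', x :: u) :: rs); split=> //; first by case: (rs) sr.
  by move=> r /[!inE] /predU1P[->//|rrs]; apply: hr; rewrite inE rrs orbT.
exists ((b, [:: x]) :: (b', u) :: rs); split=> //=; first by rewrite eq_sym bb.
by move=> r; rewrite in_cons => /predU1P[->//|]; exact: hr.
Qed.

Variables (Z : AA) (B P : AA -> Prop).
Hypothesis ZB : free_pair Z B.
Hypothesis PB : forall x, P x -> B x.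
Hypothesis B_wick : forall w, letters B w -> B (wick w).
Hypothesis P_wick : forall w, w != [::] -> letters P w -> phi (wick w) = 0.
Hypothesis Z_wick : forall n, (0 < n)%N -> phi (wick (nseq n Z)) = 0.

Let tagged (b : bool) x := if b then x = Z else P x.

Let phi_tagged b x : tagged b x -> phi x = 0.
Proof.
case: b => [->|Px]; first by rewrite -(wick1 phi Z) (@Z_wick 1).
by rewrite -(wick1 phi x) P_wick// => y /[!inE] /eqP ->.
Qed.

Let tagged_in_factor b x : tagged b x -> in_factor Z B b x.
Proof.
case: b => [->|Px]; last exact: PB.
by exists 'X; rewrite horner_algX.
Qed.

Let phi_cross a b x y : a != b -> tagged a x -> tagged b y -> phi (x * y) = 0.
Proof.
move=> ab ax byy.
have := ZB (l := [:: (a, x); (b, y)]); rewrite big_cons big_seq1; apply => //=.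
  by rewrite ab.
move=> p /[!inE] /orP[] /eqP -> /=; split;
  by [exact: phi_tagged ax|exact: phi_tagged byy|exact: tagged_in_factor].
Qed.

Let tagged_run (r : bool * seq AA) := forall x, x \in r.2 -> tagged r.1 x.

(** Freeness makes letters of different tags uncorrelated, so [wick_cat] applies at every change of
    tag. The factors are centered and alternate, which is the shape that [free_pair] requires. *)
Let wick_runs (rs : seq (bool * seq AA)) :
  sorted (fun a b : bool * seq AA => a.1 != b.1) rs ->
  (forall r, r \in rs -> r.2 != [::] /\ tagged_run r) ->
  wick (flatten [seq r.2 | r <- rs]) = \prod_(r <- rs) wick r.2.
Proof.
elim: rs => [|[b u] rs IH] srs hrs; first by rewrite big_nil wick_nil.
rewrite big_cons /= wick_cat ?IH//.
- exact: path_sorted srs.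
- by move=> r rrs; apply: hrs; rewrite inE rrs orbT.
have [u0 ub] := hrs _ (mem_head _ _).
case: rs srs hrs {IH} => [|[b' v] rs] /= srs hrs; first by rewrite mulr0 linear0.
have [|v0 vb] := hrs (b', v); first by rewrite !inE eqxx orbT.
apply: (@phi_cross b b'); first by case/andP: srs.
  case: u u0 ub {hrs} => [//|x u] _ /= ub.
  by apply: ub; exact: mem_last.
case: v v0 vb {srs hrs} => [//|y v] _ /= vb.
by apply: vb; exact: mem_head.
Qed.

Let phi_wick_letters w : w != [::] -> (forall x, x \in w -> x = Z \/ P x) ->
  phi (wick w) = 0.
Proof.
move=> w0 hw; have [rs [wE srs rs0]] := run_decomposition [seq (x == Z, x) | x <- w].
have wE' : w = flatten [seq r.2 | r <- rs].
  have -> : w = [seq p.2 | p <- [seq (x == Z, x) | x <- w]] by rewrite -map_comp map_id.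
  rewrite wE map_flatten -map_comp; congr flatten; apply: eq_map => r /=.
  by rewrite -map_comp map_id.
have hrs r : r \in rs -> r.2 != [::] /\ tagged_run r.
  move=> rrs; split=> [|x xr]; first exact: rs0.
  have : (r.1, x) \in [seq (x == Z, x) | x <- w].
    rewrite wE; apply/flatten_mapP; exists r => //.
    by apply/mapP; exists x.
  move=> /mapP[y yw [-> ->]]; rewrite /tagged; case: eqVneq => // yZ.
  by have [/eqP|//] := hw _ yw; rewrite (negPf yZ).
rewrite wE' wick_runs// -(big_map (fun r => (r.1, wick r.2)) xpredT (fun p => p.2)).
apply: ZB.
- by case: rs wE' w0 {wE srs rs0 hrs} => [->|].
- by rewrite sorted_map; exact: srs.
move=> p /mapP[[b u] /hrs[u0 ub] ->] /=.
move: u0 ub; rewrite /tagged_run /=; case: b => u0 ub.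
  have -> : u = nseq (size u) Z by apply/all_pred1P/allP => x /ub /= /eqP.
  split; last exact: wick_horner.
  by rewrite Z_wick// lt0n size_eq0.
split; first exact: P_wick.
by apply: B_wick => x /ub/PB.
Qed.

Lemma phi_wick_extension w : w != [::] ->
  (forall x, x \in w -> exists2 p, P p & exists c, x = p + c *: Z) ->
  phi (wick w) = 0.
Proof.
(* Multilinear expansion, one letter at a time: [u] holds the letters already split, [v] those still
   mixed. *)
suff H u v : u ++ v != [::] -> (forall x, x \in u -> x = Z \/ P x) ->
    (forall x, x \in v -> exists2 p, P p & exists c, x = p + c *: Z) ->
    phi (wick (u ++ v)) = 0 by move=> w0 hw; exact: (H [::]).
elim: v u => [|x v IH] u uv hu hv; first by rewrite cats0 phi_wick_letters// -(cats0 u).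
have [p Pp [c ->]] := hv _ (mem_head _ _).
rewrite wick_linear (linearD phi) (linearZ_LR phi) -!cat_rcons.
have ne y : rcons u y ++ v != [::] by case: (u).
have hv' y : y \in v -> exists2 p, P p & exists c, y = p + c *: Z.
  by move=> yv; apply: hv; rewrite inE yv orbT.
rewrite !IH// ?mulr0 ?addr0// => y; rewrite mem_rcons inE => /predU1P[->|/hu//].
  by left.
by right.
Qed.

End free_extension.

(** * Semicircular elements and Chebyshev polynomials *)

Section semicircular_moments.
Context (C : numClosedFieldType) (AA : algType C) (phi : {scalar AA}) (Z : AA).
Local Notation tau := (phi (Z * Z)).

(* Integration by parts against the density [sqrt (4 tau - x^2)]. *)
Hypothesis moments : forall n,
  n.+3%:R * phi (Z ^+ n.+1) = 4 * tau * n%:R * phi (Z ^+ n.-1).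

(* Chebyshev polynomials of the second kind, rescaled to variance [tau]. *)
Fixpoint chebyshev n : {poly C} :=
  if n is n1.+1 then
    if n1 is n2.+1 then 'X * chebyshev n1 - tau%:P * chebyshev n2 else 'X
  else 1.

Let L (p : {poly C}) := phi (horner_alg Z p).

Let LD p r : L (p + r) = L p + L r.
Proof. by rewrite /L rmorphD (linearD phi). Qed.
Let LN p : L (- p) = - L p.
Proof. by rewrite /L rmorphN (linearN phi). Qed.
Let LC c p : L (c%:P * p) = c * L p.
Proof. by rewrite /L rmorphM /= horner_algC mulr_algl (linearZ_LR phi). Qed.

Lemma wick_chebyshev n : wick phi (nseq n Z) = horner_alg Z (chebyshev n).
Proof.
suff [] : wick phi (nseq n Z) = horner_alg Z (chebyshev n) /\
    wick phi (nseq n.+1 Z) = horner_alg Z (chebyshev n.+1) by [].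
elim: n => [|n [IH1 IH2]].
  by rewrite /= wick_nil wick1 rmorph1 horner_algX.
split=> //; rewrite [nseq _ _]/= wick_cons -/(nseq n.+1 Z) IH2 /= IH1.
by rewrite rmorphB !rmorphM /= horner_algX horner_algC mulr_algl.
Qed.

(** The rescaled form of the classical identity [(1 - x^2) U_n' = (n + 1) U_(n-1) - n x U_n]. *)
Lemma chebyshev_deriv n : (4 * tau%:P - 'X ^+ 2) * (chebyshev n.+1)^`() =
  2 * n.+2%:R * tau%:P * chebyshev n - n.+1%:R * 'X * chebyshev n.+1.
Proof.
pose A := 4 * tau%:P - 'X ^+ 2 : {poly C}.
pose E k := A * (chebyshev k.+1)^`() =
  2 * k.+2%:R * tau%:P * chebyshev k - k.+1%:R * 'X * chebyshev k.+1.
suff [] : E n /\ E n.+1 by [].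
elim: n => [|n [E1 E2]].
  rewrite /E /A /= derivB !derivM derivX derivC.
  by rewrite (_ : 1^`() = 0 :> {poly C}) -?polyC1 ?derivC// polyC1; split; ring.
split=> //; rewrite /E [chebyshev n.+3]/= -/(chebyshev n.+2) -/(chebyshev n.+1).
rewrite derivB !derivM derivX derivC.
rewrite mul1r mul0r add0r mulrBr mulrDr [X in _ + X - _]mulrCA [X in _ - X]mulrCA.
rewrite E1 E2 (_ : chebyshev n.+2 = 'X * chebyshev n.+1 - tau%:P * chebyshev n)//.
rewrite /A; ring.
Qed.

Let LMn n p : L (n%:R * p) = n%:R * L p.
Proof. by rewrite /L mulr_natl rmorphMn (raddfMn phi) mulr_natl. Qed.

(** Times the semicircle density, the argument of [L] is up to a constant the derivative of
    [(4 tau - x^2)^(3/2) p]. Algebraically the identity is [moments], monomial by monomial. *)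
Let L_stein p : L ((4 * tau%:P - 'X ^+ 2) * p^`() - 3 * 'X * p) = 0.
Proof.
have LX n : L 'X^n = phi (Z ^+ n) by rewrite /L rmorphXn /= horner_algX.
have L0 : L 0 = 0 by rewrite -(mul0r 0) -[0 in X in X * _]polyC0 LC mul0r.
rewrite -[p]coefK poly_def; elim/big_ind: _ => [|p1 p2 H1 H2|i _].
- by rewrite deriv0 !mulr0 subrr.
- rewrite derivD !mulrDr opprD addrACA LD H1 H2 addr0 //.
move: (nat_of_ord i) (p`_i) => [|k] c; rewrite derivZ -!mul_polyC derivXn.
  rewrite mulr0n !mulr0 sub0r mulr1 LN [3 * 'X * _]mulrC LC LMn /= -['X]expr1 LX.
  have /eqP := moments 0; rewrite mulr0 mul0r mulf_eq0 pnatr_eq0 /= => /eqP ->.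
  by rewrite !mulr0 oppr0.
rewrite [_.-1]/=.
have -> : (4 * tau%:P - 'X ^+ 2) * (c%:P * ('X^k *+ k.+1)) -
    3 * 'X * (c%:P * 'X^(k.+1)) = c%:P *
    (4%:R * (k.+1%:R * (tau%:P * 'X^k)) - k.+4%:R * 'X^(k.+2)) :> {poly C}.
  by rewrite !exprS -mulr_natr; ring.
by rewrite LC LD LN !LMn LC !LX moments /=; ring.
Qed.

(** [L_stein] at a Chebyshev polynomial becomes, through [chebyshev_deriv], a two-step recurrence.
    Its factor [k%:R] vanishes at [k = 0], which cuts the even degrees off from [L 1 = phi 1]. *)
Lemma phi_wick_semicircular n : (0 < n)%N -> phi (wick phi (nseq n Z)) = 0.
Proof.
rewrite wick_chebyshev -/(L _); case: n => // n _.
suff [] : L (chebyshev n.+1) = 0 /\ L (chebyshev n.+2) = 0 by [].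
have step k : k.+4%:R * L (chebyshev k.+2) = k%:R * (tau * L (chebyshev k)).
  have := L_stein (chebyshev k.+1); rewrite chebyshev_deriv.
  have -> : 2 * k.+2%:R * tau%:P * chebyshev k - k.+1%:R * 'X * chebyshev k.+1 -
      3 * 'X * chebyshev k.+1 =
      k%:R * (tau%:P * chebyshev k) - k.+4%:R * chebyshev k.+2.
    rewrite (_ : chebyshev k.+2 = 'X * chebyshev k.+1 - tau%:P * chebyshev k)//.
    by ring.
  by rewrite LD LN !LMn LC => /eqP; rewrite subr_eq0 => /eqP ->.
have c1 : L (chebyshev 1) = 0.
  have := L_stein 1; rewrite -polyC1 derivC polyC1 mulr0 mulr1 sub0r LN LMn.
  by move=> /eqP; rewrite oppr_eq0 mulf_eq0 pnatr_eq0 /= => /eqP.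
elim: n => [|n [IH1 IH2]]; split=> //.
  by have /eqP := step 0; rewrite mul0r mulf_eq0 pnatr_eq0 /= => /eqP.
by have /eqP := step n.+1; rewrite IH1 !mulr0 mulf_eq0 pnatr_eq0 /= => /eqP.
Qed.

End semicircular_moments.

(** * Overlapping increments and their common partition *)

Section free_increments.
Context (R : realDomainType) (C : numClosedFieldType) (AA : algType C).
Context (phi : {scalar AA}) (At : R -> AA -> Prop) (S : R -> AA).
Local Notation wick := (wick phi).
Hypothesis At1 : forall t, 0 <= t -> At t 1.
Hypothesis At_linear : forall t a x y, 0 <= t -> At t x -> At t y -> At t (a *: x + y).
Hypothesis At_mul : forall t x y, 0 <= t -> At t x -> At t y -> At t (x * y).
Hypothesis At_le : forall u t x, 0 <= u -> u < t -> At u x -> At t x.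
Hypothesis S_At : forall t, 0 <= t -> At t (S t).
Hypothesis S0 : S 0 = 0.
Hypothesis S_free : forall u t, 0 <= u -> u < t ->
  free_pair phi (S t - S u) (At u).
Hypothesis S_wick : forall u t n, 0 <= u -> u < t -> (0 < n)%N ->
  phi (wick (nseq n (S t - S u))) = 0.

Lemma At_wick t w : 0 <= t -> letters (At t) w -> At t (wick w).
Proof.
move=> t0; have [n] := ubnP (size w); elim: n w => // n IH [|x w] /= wn Aw.
  by rewrite wick_nil; exact: At1.
have Ax : At t x by apply: Aw; rewrite mem_head.
have Aw' : letters (At t) w by move=> y yw; apply: Aw; rewrite inE yw orbT.
rewrite wick_cons addrC -scaleNr; apply: At_linear => //.
  apply: IH; first by rewrite size_behead (leq_ltn_trans (leq_pred _)).
  by move=> y /mem_behead/Aw'.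
by apply: At_mul => //; exact: IH.
Qed.

(* The times in [ts] are meant to be decreasing; the empty list has head 0. *)
Fixpoint span_times (ts : seq R) (x : AA) : Prop :=
  if ts is t :: ts' then
    exists2 p, span_times ts' p & exists c, x = p + c *: (S t - S (head 0 ts'))
  else x = 0.

Lemma span_times0 ts : span_times ts 0.
Proof.
elim: ts => //= t ts IH; exists 0 => //.
by exists 0; rewrite scale0r addr0.
Qed.

Lemma span_times_linear ts a x y : span_times ts x -> span_times ts y ->
  span_times ts (a *: x + y).
Proof.
elim: ts x y => [|t ts IH] x y /=; first by move=> -> ->; rewrite scaler0 addr0.
move=> [p hp [c ->]] [p' hp' [c' ->]]; exists (a *: p + p'); first exact: IH.
exists (a * c + c'); rewrite scalerDr scalerA addrACA; congr (_ + _).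
by rewrite -scalerDl.
Qed.

Lemma span_times_head ts : span_times ts (S (head 0 ts)).
Proof.
case: ts => [|t ts] //=; suff hts : span_times ts (S (head 0 ts)).
  by exists (S (head 0 ts)) => //; exists 1; rewrite scale1r addrC subrK.
elim: ts => [|u ts IH] //=.
by exists (S (head 0 ts)) => //; exists 1; rewrite scale1r addrC subrK.
Qed.

Lemma span_times_mem ts t : t \in ts -> span_times ts (S t).
Proof.
elim: ts => // u ts IH; rewrite inE => /predU1P[->|/IH St].
  exact: (span_times_head (u :: ts)).
by exists (S t) => //; exists 0; rewrite scale0r addr0.
Qed.

(** Appending 0 includes positivity of the last time in the same sortedness condition. *)
Let pos_decreasing (ts : seq R) := sorted (fun a b : R => b < a) (rcons ts 0).

Let head_ge0 ts : pos_decreasing ts -> 0 <= head 0 ts.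
Proof.
case: ts => //= t ts; rewrite /pos_decreasing /= rcons_path => /andP[+ lt0].
have gt_trans : transitive (fun a b : R => b < a).
  by move=> ? ? ? /[swap]; exact: lt_trans.
rewrite (path_sortedE gt_trans) => /andP[/allP ts_t _].
case: (lastP ts) lt0 ts_t => [/ltW//|ts' u]; rewrite last_rcons => u0 ts_t.
by rewrite (le_trans (ltW u0))// ltW// ts_t// mem_rcons mem_head.
Qed.

Let span_times_At ts x : pos_decreasing ts -> span_times ts x -> At (head 0 ts) x.
Proof.
elim: ts x => [|t ts IH] x /= dts.
  have := At_linear (-1) (lexx 0) (At1 (lexx 0)) (At1 (lexx 0)).
  by rewrite scaleN1r addNr => + ->.
have t0 := head_ge0 dts.
have dts' : pos_decreasing ts by move: dts; exact: path_sorted.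
have ht : head 0 ts < t.
  by move: dts; rewrite /pos_decreasing; case: (ts) => [|u ts'] /= /andP[].
have h0 := head_ge0 dts'.
move=> [p hp [c ->]]; rewrite addrC.
apply: At_linear => //; last by apply: At_le (IH _ dts' hp).
rewrite addrC -scaleN1r; apply: At_linear => //; last exact: S_At.
by apply: At_le (S_At h0).
Qed.

(** Induction on the number of times: the latest increment is free from the algebra at the preceding
    time, which contains the span of all earlier ones. *)
Lemma phi_wick_span_times ts w : pos_decreasing ts -> w != [::] ->
  letters (span_times ts) w -> phi (wick w) = 0.
Proof.
elim: ts w => [|t ts IH] w dts w0 hw.
  case: w w0 hw => // x w _ hw; have -> : x = 0 by apply: hw; rewrite mem_head.
  by rewrite wick_cons !mul0r (linear0 phi) scale0r subr0 (linear0 phi).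
have dts' : pos_decreasing ts by move: dts; exact: path_sorted.
have h0 := head_ge0 dts'.
have ht : head 0 ts < t.
  by move: dts; rewrite /pos_decreasing; case: (ts) => [|u ts'] /= /andP[].
apply: (phi_wick_extension (S_free h0 ht)) => //.
- by move=> x; exact: span_times_At.
- by move=> w' hw'; exact: At_wick.
- by move=> w' w'0; exact: IH.
- by move=> n n0; exact: S_wick.
- by move=> x /hw.
Qed.

Lemma phi_wick_increments w : w != [::] ->
  letters (fun x => exists s t, [/\ 0 <= s, 0 <= t & x = S t - S s]) w ->
  phi (wick w) = 0.
Proof.
move=> w0 hw.
suff [ts ts0 hts] : exists2 ts : seq R, (forall t : R, t \in ts -> 0 <= t) &
    forall x, x \in w -> exists s t, [/\ s \in ts, t \in ts & x = S t - S s].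
  (* Time 0 is dropped because [pos_decreasing] demands positive times; [S 0 = 0] lies in every span
     anyway. *)
  pose us := sort >=%R (undup [seq t <- ts | t != 0]).
  have mem_us t : t \in us = (t != 0) && (t \in ts).
    by rewrite mem_sort mem_undup mem_filter.
  have Sus t : t \in ts -> span_times us (S t).
    have [->|t0 tts] := eqVneq t 0; first by rewrite S0 => _; exact: span_times0.
    by apply: span_times_mem; rewrite mem_us t0.
  apply: (@phi_wick_span_times us) => //; last first.
    move=> x /hts[s [t [/Sus Ss /Sus St ->]]].
    by rewrite addrC -scaleN1r; exact: span_times_linear.
  rewrite /pos_decreasing sorted_pairwise; last first.
    by move=> ? ? ? /[swap]; exact: lt_trans.
  rewrite pairwise_rcons -sorted_pairwise; last first.
    by move=> ? ? ? /[swap]; exact: lt_trans.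
  apply/andP; split.
    by apply/allP => t; rewrite mem_us lt0r => /andP[-> /ts0].
  (* The dual order turns strictly decreasing into strictly increasing. *)
  have := @lt_sorted_uniq_le _ (R^d)%type us; rewrite sort_uniq undup_uniq => ->.
  by apply: sort_sorted => a b; exact: le_total.
elim: w hw {w0} => [|x w IH] hw; first by exists [::].
have [y yw|ts ts0 hts] := IH; first by apply: hw; rewrite inE yw orbT.
have [s [t [s0 t0 xE]]] := hw _ (mem_head _ _).
exists [:: s, t & ts].
  by move=> u /[!inE] /or3P[/eqP->|/eqP->|/ts0].
move=> y /[!inE] /predU1P[->|/hts[s' [t' [s't t't yE]]]].
  by exists s, t; rewrite !inE !eqxx orbT.
by exists s', t'; rewrite !inE s't t't !orbT.
Qed.

End free_increments.

(** * Moments of the semicircular and free Poisson laws *)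

Section density_integral.
Context (R : realType) (g : measurableTypeR R -> R).
Variables (mg : measurable_fun setT g) (g0 : forall x, 0 <= g x).
Local Notation mu := (density_measure mg g0).
Local Notation leb := (@lebesgue_measure R).
Local Open Scope ereal_scope.

Let integral_density_indic E : measurable E ->
  \int[mu]_x (\1_E x)%:E = \int[leb]_x ((\1_E x)%:E * (g x)%:E).
Proof.
move=> mE; rewrite integral_indic// setIT [LHS]integral_mkcond.
apply: eq_integral => x _; rewrite patchE indicE.
by case: (x \in E); rewrite ?mul1e ?mul0e.
Qed.

Import HBNNSimple.

Let integral_density_nnsfun (h : {nnsfun measurableTypeR R >-> R}) :
  \int[mu]_x (h x)%:E = \int[leb]_x ((h x)%:E * (g x)%:E).
Proof.
under [LHS]eq_integral do rewrite fimfunE -fsumEFin//.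
rewrite [LHS]ge0_integral_fsum//; last 2 first.
  - by move=> r; exact/measurable_EFinP/measurableT_comp.
  - by move=> n x _; rewrite EFinM nnfun_muleindic_ge0.
under [RHS]eq_integral.
  move=> x xD; rewrite fimfunE -fsumEFin// ge0_mule_fsuml; last first.
    by move=> r; rewrite EFinM nnfun_muleindic_ge0.
  over.
rewrite [RHS]ge0_integral_fsum//; last 2 first.
  - move=> r; apply: emeasurable_funM; last exact/measurable_EFinP.
    by apply/measurable_EFinP/measurableT_comp.
  - by move=> n x _; rewrite EFinM mule_ge0// ?nnfun_muleindic_ge0// lee_fin.
apply: eq_fsbigr => r _.
under eq_integral do rewrite EFinM.
under [RHS]eq_integral do rewrite EFinM -muleA.
have [r0|r0] := leP 0%R r; last first.
  rewrite preimage_nnfun0//.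
  under eq_integral do rewrite indic0 mule0.
  under [RHS]eq_integral do rewrite indic0 mul0e mule0.
  by rewrite !integral0.
rewrite !ge0_integralZl//.
- by rewrite integral_density_indic.
- by apply: emeasurable_funM; exact/measurable_EFinP.
- by move=> x _; rewrite mule_ge0 // lee_fin.
- exact/measurable_EFinP.
Qed.

Lemma ge0_integral_density (f : measurableTypeR R -> \bar R) :
  measurable_fun setT f -> (forall x, 0 <= f x) ->
  \int[mu]_x f x = \int[leb]_x (f x * (g x)%:E).
Proof.
move=> mf f0; pose f_ := nnsfun_approx measurableT mf.
transitivity (limn (fun n => \int[mu]_x (f_ n x)%:E)).
  rewrite -monotone_convergence//=.
  - apply: eq_integral => x _; apply/esym/cvg_lim => //=.
    exact: cvg_nnsfun_approx.
  - by move=> n; apply: measurableT_comp => //; exact: measurable_funTS.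
  - by move=> n x _; rewrite lee_fin.
  - by move=> x _ a b ab; rewrite lee_fin//; exact/lefP/nd_nnsfun_approx.
rewrite (_ : \int[leb]_x _ =
    limn (fun n => \int[leb]_x ((f_ n x)%:E * (g x)%:E))); last first.
  rewrite -monotone_convergence//=.
  - apply: eq_integral => x _; apply/esym/cvg_lim => //.
    apply: cvgeZr => //.
    exact: cvg_nnsfun_approx.
  - by move=> n; apply: emeasurable_funM; exact/measurable_EFinP.
  - by move=> n x _; rewrite mule_ge0// lee_fin.
  - move=> x _ a b ab; rewrite lee_wpmul2r ?lee_fin//.
    exact/lefP/nd_nnsfun_approx.
by congr (limn _); apply/funext => n; rewrite integral_density_nnsfun.
Qed.

Lemma integral_density (f : measurableTypeR R -> R) : measurable_fun setT f ->
  \int[mu]_x (f x)%:E = \int[leb]_x (f x * g x)%:E.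
Proof.
move=> mf; have mEf : measurable_fun setT (EFin \o f) by exact/measurable_EFinP.
rewrite integralE [RHS]integralE.
rewrite !ge0_integral_density//; [|exact: measurable_funeneg|exact: measurable_funepos].
congr (_ - _); apply: eq_integral => x _; rewrite ?funeposE ?funenegE EFinM.
  by rewrite maxe_pMl// ?mul0e// lee_fin.
by rewrite maxe_pMl// ?mul0e ?mulNe// lee_fin.
Qed.

End density_integral.

Section semicircle_integral.
Context (R : realType) (t c : R).
Hypothesis t0 : 0 < t.
Local Notation leb := (@lebesgue_measure R).

Let w (x : R) : R := Num.sqrt (4 * t - (x - c) ^+ 2).
Let a := c - 2 * Num.sqrt t.
Let b := c + 2 * Num.sqrt t.

(** Center 0 serves the semicircular law, center [1 + lambda] the free Poisson density multiplied by
    [x]. [Num.sqrt] is 0 on negative numbers, so the integral may run over the whole line. *)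
Definition semicircle_integral (f : R -> R) : R :=
  \int[leb]_x (f x * Num.sqrt (4 * t - (x - c) ^+ 2)).

Let ab : a < b.
Proof.
by rewrite ltrD2l gtrN// mulr_gt0// sqrtr_gt0.
Qed.

Let w_gt0 (x : R) : (a < x < b) = (0 < 4 * t - (x - c) ^+ 2).
Proof.
have st : 0 < 2 * Num.sqrt t by rewrite mulr_gt0 ?sqrtr_gt0.
have -> : 4 * t = (2 * Num.sqrt t) ^+ 2.
  by rewrite exprMn sqr_sqrtr ?ltW//; ring.
rewrite subr_gt0 -[RHS]ltr_sqrt ?exprn_gt0// !sqrtr_sqr (gtr0_norm st).
by rewrite ltr_norml /a /b [in RHS]ltrBlDl [in RHS]ltrBrDl.
Qed.

Let w_out (x : R) : ~~ (a < x < b) -> w x = 0.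
Proof. by rewrite w_gt0 -leNgt => ?; rewrite /w ler0_sqrtr. Qed.

Let w_continuous : continuous w.
Proof.
move=> x; apply: continuous_comp; last exact: sqrt_continuous.
apply: cvgB; first exact: cvg_cst.
apply: (@continuous_comp _ _ _ (fun x => x - c) (fun x => x ^+ 2)).
  by apply: cvgB; [exact: cvg_id|exact: cvg_cst].
exact: exprn_continuous.
Qed.

Lemma semicircle_integrable (f : R -> R) : continuous f ->
  leb.-integrable setT
    (fun x => (f x * Num.sqrt (4 * t - (x - c) ^+ 2))%:E).
Proof.
move=> cf.
rewrite (_ : (fun x => _) = (EFin \o (fun x => f x * w x)) \_ `[a, b]); last first.
  apply/funext => x; rewrite patchE; case: ifPn => // /negP xab.
  rewrite -/(w x) w_out ?mulr0//; apply/negP => /andP[ax xb]; apply: xab.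
  by rewrite inE /= in_itv /= !ltW.
apply/integrable_restrict => //; rewrite setTI.
apply: continuous_compact_integrable; first exact: segment_compact.
by apply: continuous_subspaceT => x; apply: cvgM; [exact: cf|exact: w_continuous].
Qed.

Lemma semicircle_integralD (f g : R -> R) : continuous f -> continuous g ->
  semicircle_integral (fun x => f x + g x) =
  semicircle_integral f + semicircle_integral g.
Proof.
move=> cf cg; rewrite -RintegralD//; [|exact: semicircle_integrable..].
by apply: eq_Rintegral => x _; rewrite mulrDl.
Qed.

Lemma semicircle_integralZ r (f : R -> R) : continuous f ->
  semicircle_integral (fun x => r * f x) = r * semicircle_integral f.
Proof.
move=> cf; rewrite -RintegralZl//; last exact: semicircle_integrable.
by apply: eq_Rintegral => x _; rewrite mulrA.
Qed.

Lemma pow_continuous k : continuous (fun x : R => (x - c) ^+ k).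
Proof.
move=> x; apply: (@continuous_comp _ _ _ (fun x => x - c) (fun x => x ^+ k)).
  by apply: cvgB; [exact: cvg_id|exact: cvg_cst].
exact: exprn_continuous.
Qed.

Lemma semicircle_integral_rec k :
  k.+3%:R * semicircle_integral (fun x => (x - c) ^+ k.+1) =
  4 * t * k%:R * semicircle_integral (fun x => (x - c) ^+ k.-1).
Proof.
pose f (x : R) : R := (4 * t * k%:R * (x - c) ^+ k.-1 - k.+3%:R * (x - c) ^+ k.+1).
have cf : continuous f.
  move=> x; apply: cvgB; apply: cvgM; try exact: cvg_cst; exact: pow_continuous.
(* A primitive of [f * w]: the power 3/2 of [4 * t - (x - c) ^+ 2], times [(x - c) ^+ k]. It
   vanishes at both ends of the support, and the recurrence is the resulting zero integral. *)
pose F (x : R) : R := (4 * t - (x - c) ^+ 2) * w x * (x - c) ^+ k.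
have cF : continuous F.
  move=> x; apply: cvgM; last exact: pow_continuous.
  apply: cvgM; last exact: w_continuous.
  by apply: cvgB; [exact: cvg_cst|exact: pow_continuous].
have dF (x : R) : x \in `]a, b[ -> is_derive x 1 F (f x * w x).
  rewrite in_itv /= w_gt0 => h0.
  have dh : is_derive x 1 (fun x : R => 4 * t - (x - c) ^+ 2) (- (2 * (x - c))).
    by apply: is_derive_eq; rewrite /GRing.scale /=; ring.
  have dw : is_derive x 1 w ((2 * w x)^-1 * - (2 * (x - c))).
    exact: (@is_derive1_comp R Num.sqrt (fun x : R => 4 * t - (x - c) ^+ 2)
      x _ _ (is_derive1_sqrt h0) dh).
  have dk : is_derive x 1 (fun x : R => (x - c) ^+ k) (k%:R * (x - c) ^+ k.-1).
    have d1 : is_derive x 1 (fun x : R => x - c) 1.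
      by apply: is_derive_eq; rewrite subr0.
    have := is_deriveX k d1; rewrite exprfctE => dk.
    by apply: (is_derive_eq dk); rewrite /GRing.scale /= mulr1.
  have wx0 : 0 < w x by rewrite sqrtr_gt0.
  have ww : 4 * t - (x - c) ^+ 2 = w x * w x by rewrite -expr2 sqr_sqrtr// ltW.
  have wn0 : w x != 0 by rewrite gt_eqF.
  apply: (is_derive_eq (is_deriveM (is_deriveM dh dw) dk)).
  have t4 : 4 * t = w x * w x + (x - c) ^+ 2 by rewrite -ww subrK.
  rewrite /GRing.scale /= -[(_ * w) x]/((4 * t - (x - c) ^+ 2) * w x) ww /f t4.
  by case: (k) => [|j]; rewrite ?exprS /=; field.
have : (\int[leb]_(x in `[a, b]) (f x * w x)%:E = (F b)%:E - (F a)%:E)%E.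
  apply: continuous_FTC2 => //.
  - by apply: continuous_subspaceT => y; apply: cvgM; [exact: cf|exact: w_continuous].
  - split=> [y /dF []//||].
      by apply: cvg_at_right_filter; exact: cF.
    by apply: cvg_at_left_filter; exact: cF.
  - by move=> x /dF dFx; rewrite derive1E derive_val.
have -> : F b = 0 by rewrite /F w_out ?mulr0 ?mul0r// ltxx andbF.
have -> : F a = 0 by rewrite /F w_out ?mulr0 ?mul0r// ltxx.
rewrite subee// => fw0.
have : semicircle_integral f = 0.
  rewrite /semicircle_integral /Rintegral -[RHS]/(fine 0%E) -fw0.
  rewrite [in RHS]integral_mkcond.
  congr fine; apply: eq_integral => x _; rewrite patchE.
  case: ifPn => // /negP xab.
  rewrite -/(w x) w_out ?mulr0//; apply/negP => /andP[ax xb]; apply: xab.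
  by rewrite inE /= in_itv /= !ltW.
rewrite /f semicircle_integralD; last 2 first.
- by move=> x; apply: cvgM; [exact: cvg_cst|exact: pow_continuous].
- by move=> x; apply: cvgN; apply: cvgM; [exact: cvg_cst|exact: pow_continuous].
under [X in _ + semicircle_integral X]eq_fun do rewrite -mulNr.
rewrite !semicircle_integralZ; try exact: pow_continuous.
by rewrite mulNr => /eqP; rewrite subr_eq0 => /eqP.
Qed.

(** Odd central moments vanish and the second is [t] times the mass, which stays unevaluated. Degree
    3 is enough for fourth moments of the free Poisson law, where one factor [x] is divided out. *)
Lemma semicircle_integral_cubic (a0 a1 a2 a3 : R) :
  semicircle_integral (fun x => a3 * (x - c) ^+ 3 + a2 * (x - c) ^+ 2 +
    a1 * (x - c) + a0) = (a2 * t + a0) * semicircle_integral (fun=> 1).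
Proof.
have rec0 := semicircle_integral_rec 0; have rec1 := semicircle_integral_rec 1.
have rec2 := semicircle_integral_rec 2; rewrite /= in rec0 rec1 rec2.
have E0 : (fun x : R => (x - c) ^+ 0) = (fun=> 1) by apply/funext => x; rewrite expr0.
rewrite E0 in rec1.
have J1 : semicircle_integral (fun x => (x - c) ^+ 1) = 0.
  by move: rec0; rewrite mulr0 mul0r => /eqP; rewrite mulf_eq0 pnatr_eq0 /= => /eqP.
have J3 : semicircle_integral (fun x => (x - c) ^+ 3) = 0.
  by move: rec2; rewrite J1 mulr0 => /eqP; rewrite mulf_eq0 pnatr_eq0 /= => /eqP.
have J2 : semicircle_integral (fun x => (x - c) ^+ 2) =
    t * semicircle_integral (fun=> 1).
  by apply: (@mulfI _ 4%:R); rewrite ?pnatr_eq0// rec1; ring.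
have cz k (r : R) : continuous (fun x : R => r * (x - c) ^+ k).
  by move=> x; apply: cvgM; [exact: cvg_cst|exact: pow_continuous].
transitivity (semicircle_integral (fun x => a3 * (x - c) ^+ 3 +
    (a2 * (x - c) ^+ 2 + (a1 * (x - c) ^+ 1 + a0 * (x - c) ^+ 0)))).
  by congr semicircle_integral; apply/funext => x; ring.
have cD f g : continuous f -> continuous g -> continuous (fun x : R => f x + g x : R).
  by move=> cf cg x; apply: cvgD; [exact: cf|exact: cg].
have c10 := cD _ _ (cz 1 a1) (cz 0 a0).
have c210 := cD _ _ (cz 2 a2) c10.
rewrite (semicircle_integralD (cz 3 a3) c210).
rewrite (semicircle_integralD (cz 2 a2) c10) (semicircle_integralD (cz 1 a1) (cz 0 a0)).
rewrite !semicircle_integralZ; try exact: pow_continuous.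
by rewrite J1 J2 J3 E0; ring.
Qed.

End semicircle_integral.

Lemma integral_mscale_dirac d (T : measurableType d) (R : realType)
    (k : {nonneg R}) (x : T) (f : T -> R) : measurable_fun setT f ->
  (\int[mscale k \d_x]_y (f y)%:E = (k%:num * f x)%:E)%E.
Proof.
move=> mf; have mEf : measurable_fun setT (EFin \o f) by exact/measurable_EFinP.
have mfp := measurable_funepos mEf; have mfn := measurable_funeneg mEf.
rewrite integralE !ge0_integral_mscale// !integral_dirac// !diracT !mul1e EFinM.
rewrite -muleBr//; last by rewrite add_def_funeposneg.
by rewrite -[in RHS]/((EFin \o f) x) [in RHS](funeposneg (EFin \o f)).
Qed.

Section law_moments.
Context (R : realType).
Local Notation leb := (@lebesgue_measure R).

Lemma semicircular_pdfE (t x : R) : 0 < t ->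
  semicircular_pdf t x = (2 * pi * t)^-1 * Num.sqrt (4 * t - (x - 0) ^+ 2).
Proof.
move=> t0; rewrite /semicircular_pdf subr0; case: ifPn => //; rewrite -leNgt => xt.
rewrite ler0_sqrtr ?mulr0// subr_le0.
have -> : 4 * t = (2 * Num.sqrt t) ^+ 2 by rewrite exprMn sqr_sqrtr ?ltW//; ring.
by rewrite -[x ^+ 2]real_normK ?num_real// lerXn2r ?nnegrE ?mulr_ge0 ?sqrtr_ge0.
Qed.

Lemma semicircular_moment (t : R) k : 0 < t ->
  Rintegral (semicircular t) setT (fun x => x ^+ k) =
  (2 * pi * t)^-1 * semicircle_integral t 0 (fun x => (x - 0) ^+ k).
Proof.
move=> t0; rewrite -RintegralZl//; last first.
  exact: (semicircle_integrable 0 t0 (@pow_continuous _ 0 k)).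
rewrite /Rintegral integral_density//.
congr fine; apply: eq_integral => x _.
by rewrite semicircular_pdfE// !subr0 mulrCA.
Qed.

Lemma semicircular_moment_rec (t : R) k : 0 < t ->
  k.+3%:R * Rintegral (semicircular t) setT (fun x => x ^+ k.+1) =
  4 * t * k%:R * Rintegral (semicircular t) setT (fun x => x ^+ k.-1).
Proof.
move=> t0; rewrite !semicircular_moment//.
by rewrite mulrCA (semicircle_integral_rec 0 t0) mulrCA.
Qed.

(** The factor [x] cancels the one in the denominator of the density and leaves a semicircle
    centered at [1 + lambda]. *)
Lemma free_poisson_pdfE (lambda x : R) : 0 < lambda ->
  x * free_poisson_pdf lambda x =
  (2 * pi)^-1 * Num.sqrt (4 * lambda - (x - (1 + lambda)) ^+ 2).
Proof.
move=> l0; have s0 : 0 < Num.sqrt lambda by rewrite sqrtr_gt0.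
have ls : lambda = Num.sqrt lambda ^+ 2 by rewrite sqr_sqrtr// ltW.
rewrite /free_poisson_pdf opprD addrA; case: ifPn => [/andP[x1 _]|xn].
  have x0 : 0 < x by rewrite (le_lt_trans _ x1)// sqr_ge0.
  by rewrite mulrA invfM mulrCA mulfV ?gt_eqF// mulr1.
rewrite mulr0 ler0_sqrtr ?mulr0// leNgt; apply: contra xn.
move: (Num.sqrt lambda) ls s0 => s -> s0.
(* With [s] the root of [lambda], the radicand factors at the two edges of the support. *)
rewrite (_ : 4 * s ^+ 2 - (x - 1 - s ^+ 2) ^+ 2 =
  (x - (1 - s) ^+ 2) * ((1 + s) ^+ 2 - x)); last by ring.
move=> h.
by rewrite !ltNge; apply/andP; split; apply/negP => hx; nra.
Qed.

Section centered_free_poisson.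
Variable lambda : R.
Hypothesis l0 : 0 < lambda.
Local Notation mu := (centered_free_poisson lambda).
Hypothesis mu_int : forall m : nat, mu.-integrable setT (fun x => (x ^+ m)%:E).
Local Notation c m := (Rintegral mu setT (fun x => x ^+ m)).
Hypothesis mu0 : c 0%N = 1.
(* Together with [mu0] this spares computing the mass of the density. *)
Hypothesis mu1 : c 1%N = 0.
Let a := if lambda <= 1 then 1 - lambda else 0.
Let dens := density_measure (measurable_free_poisson_pdf lambda)
       (free_poisson_pdf_ge0 lambda).

Let shift (x : measurableTypeR R) : measurableTypeR R := x - lambda.

Let measurable_shift : measurable_fun setT shift.
Proof. by apply: (@measurable_funB _ R). Qed.

Let atom := mscale (NngNum (free_poisson_atom_ge0 lambda))
       (@dirac _ (measurableTypeR R) 0 R).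

Let measurable_pow m :
  measurable_fun setT (fun x : measurableTypeR R => ((x - lambda) ^+ m)%:E).
Proof.
apply/measurable_EFinP; apply: (@measurable_funX _ _ R).
exact: (@measurable_funB _ _ R).
Qed.

Let shift_lty m : (\int[free_poisson lambda]_x `|((x - lambda) ^+ m)%:E| < +oo)%E.
Proof.
have /integrableP[_] := mu_int m.
rewrite (@ge0_integral_pushforward _ _ _ _ R _ measurable_shift)//.
apply: measurableT_comp => //; apply/measurable_EFinP.
exact: (@exprn_measurable R).
Qed.

Let shift_lty_add m :
  (\int[atom]_x `|((x - lambda) ^+ m)%:E| < +oo)%E /\
  (\int[dens]_x `|((x - lambda) ^+ m)%:E| < +oo)%E.
Proof.
have := shift_lty m; rewrite /free_poisson ge0_integral_measure_add//.
  move=> H; split; apply: le_lt_trans H; rewrite ?leeDl ?leeDr//; exact: integral_ge0.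
exact: measurableT_comp.
Qed.

Let moment_decomposition m :
  c m = a * (- lambda) ^+ m +
    \int[leb]_x ((x - lambda) ^+ m * free_poisson_pdf lambda x) /\
  leb.-integrable setT
    (fun x => ((x - lambda) ^+ m * free_poisson_pdf lambda x)%:E).
Proof.
have [ha hd] := shift_lty_add m.
have ia : atom.-integrable setT (fun x => ((x - lambda) ^+ m)%:E).
  by apply/integrableP; split.
have id : dens.-integrable setT (fun x => ((x - lambda) ^+ m)%:E).
  by apply/integrableP; split.
have mpow : measurable_fun setT (fun x : measurableTypeR R => (x - lambda) ^+ m).
  by apply/measurable_EFinP; exact: measurable_pow.
have il : leb.-integrable setT
    (fun x => ((x - lambda) ^+ m * free_poisson_pdf lambda x)%:E).
  apply/integrableP; split.
    apply/measurable_EFinP; apply: measurable_funM => //.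
    exact: measurable_free_poisson_pdf.
  rewrite ge0_integral_density// in hd; last exact: measurableT_comp.
  move: hd; under eq_integral do
    rewrite -[X in (_ * X)%E]gee0_abs ?lee_fin ?free_poisson_pdf_ge0// -abseM -EFinM.
  by [].
split=> //.
rewrite {1}/Rintegral.
rewrite (@integral_pushforward _ _ _ _ R _ measurable_shift)//; last 2 first.
- by apply/measurable_EFinP; exact: (@exprn_measurable R).
- rewrite preimage_setT; apply/integrableP; split; first exact: measurable_pow.
  exact: shift_lty.
rewrite preimage_setT /free_poisson integral_measure_add// fineD ?integrable_fin_num//.
congr (_ + _); last by rewrite /Rintegral integral_density.
by rewrite integral_mscale_dirac//= /shift sub0r.
Qed.

(** The constant part integrates to itself because the total mass is 1. The rest is divisible by
    [x], so it ignores the atom at 0 and meets only the shifted semicircle. *)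
Lemma centered_free_poisson_moment m (q : R -> R) : continuous q ->
  (forall x, (x - lambda) ^+ m = (- lambda) ^+ m + x * q x) ->
  c m = (- lambda) ^+ m + (2 * pi)^-1 * semicircle_integral lambda (1 + lambda) q.
Proof.
move=> cq qE; have [-> im] := moment_decomposition m.
have [mass i0] := moment_decomposition 0.
have {}i0 : leb.-integrable setT (fun x => (free_poisson_pdf lambda x)%:E).
  by apply: eq_integrable i0 => // x _; rewrite expr0 mul1r.
have {}mass : a + \int[leb]_x (free_poisson_pdf lambda x) = 1.
  rewrite mu0 expr0 mulr1 in mass; rewrite mass; congr (_ + _).
  by apply: eq_Rintegral => x _; rewrite expr0 mul1r.
have iq := semicircle_integrable (1 + lambda) l0 cq.
have -> : \int[leb]_x ((x - lambda) ^+ m * free_poisson_pdf lambda x) =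
    \int[leb]_x ((- lambda) ^+ m * free_poisson_pdf lambda x +
      (2 * pi)^-1 * (q x * Num.sqrt (4 * lambda - (x - (1 + lambda)) ^+ 2))).
  apply: eq_Rintegral => x _; rewrite qE mulrDl; congr (_ + _).
  by rewrite mulrAC free_poisson_pdfE// -mulrA; congr (_ * _); rewrite mulrC.
have integrable_scale (r : R) (f : R -> R) :
    leb.-integrable setT (fun x => (f x)%:E) ->
    leb.-integrable setT (fun x => (r * f x)%:E).
  by move=> fi; under eq_fun do rewrite EFinM; exact: integrableZl.
rewrite RintegralD//; [|exact: integrable_scale i0|exact: integrable_scale iq].
rewrite !RintegralZl// addrA; congr (_ + _).
by rewrite [a * _]mulrC -mulrDr mass mulr1.
Qed.

Lemma centered_free_poisson_moments :
  [/\ c 2%N = lambda, c 3%N = lambda & c 4%N = lambda + 2 * lambda ^+ 2].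
Proof.
pose y (x : R) := x - (1 + lambda).
pose q (a0 a1 a2 a3 x : R) := a3 * y x ^+ 3 + a2 * y x ^+ 2 + a1 * y x + a0.
have cq a0 a1 a2 a3 : continuous (q a0 a1 a2 a3).
  have cz k (r : R) : continuous (fun x : R => r * y x ^+ k : R).
    by move=> x; apply: cvgM; [exact: cvg_cst|exact: pow_continuous].
  move=> x; apply: (@cvgD _ R^o); last exact: cvg_cst.
  apply: (@cvgD _ R^o); last exact: (cz 1%N).
  by apply: (@cvgD _ R^o); [exact: (cz 3%N)|exact: (cz 2%N)].
have E m a0 a1 a2 a3 :
    (forall x, (x - lambda) ^+ m = (- lambda) ^+ m + x * q a0 a1 a2 a3 x) ->
    c m = (- lambda) ^+ m + (2 * pi)^-1 *
      ((a2 * lambda + a0) * semicircle_integral lambda (1 + lambda) (fun=> 1)).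
  move=> /centered_free_poisson_moment ->//.
  by rewrite -(semicircle_integral_cubic (1 + lambda) l0 a0 a1 a2 a3).
set J := semicircle_integral _ _ _ in E.
(* For [m = 1] the quotient is 1, and the zero mean [mu1] determines the normalization of [J]. *)
have J1 : (2 * pi)^-1 * J = lambda.
  have : c 1%N = (- lambda) ^+ 1 + (2 * pi)^-1 * ((0 * lambda + 1) * J).
    by apply: (E 1%N 1 0 0 0) => x; rewrite /q; ring.
  by rewrite mu1 mul0r add0r mul1r expr1 addrC => /eqP; rewrite eq_sym subr_eq0 => /eqP.
have {}E m a0 a1 a2 a3 :
    (forall x, (x - lambda) ^+ m = (- lambda) ^+ m + x * q a0 a1 a2 a3 x) ->
    c m = (- lambda) ^+ m + (a2 * lambda + a0) * lambda.
  by move=> /E ->; rewrite mulrCA J1.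
split.
(* The coefficients below are those of the quotient of [(x - lambda) ^+ m - (- lambda) ^+ m] by [x],
   expanded in powers of [y x]. *)
- by rewrite (E 2%N (1 - lambda) 1 0 0); [ring|move=> x; rewrite /q /y; ring].
- by rewrite (E 3%N (1 - lambda + lambda ^+ 2) (2 - lambda) 1 0);
    [ring|move=> x; rewrite /q /y; ring].
- by rewrite (E 4%N (1 - lambda + lambda ^+ 2 - lambda ^+ 3)
    (3 - 2 * lambda + lambda ^+ 2) (3 - lambda) 1);
    [ring|move=> x; rewrite /q /y; ring].
Qed.

End centered_free_poisson.
End law_moments.

(** * The algebra carried by a von Neumann algebra *)

Section operators_theory.
Context (R : realType) (H : completeNormedModType R[i]).
Variable dot : {dot H for Num.conj}.
Implicit Types (A B : set (H -> H)) (X Y : H -> H).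

Lemma dotC x y : dot x y = (dot y x)^*.
Proof. by rewrite hermC expr0 mul1r. Qed.

Lemma is_adjoint_inj X Y Y' : is_adjoint dot X Y -> is_adjoint dot X Y' -> Y = Y'.
Proof.
move=> XY XY'; apply/funext => y; apply/eqP; rewrite -subr_eq0 -(dnorm_eq0 dot).
by rewrite linearBr /= -XY -XY' subrr.
Qed.

Lemma adjointP X Y : is_adjoint dot X Y -> adjoint dot X = Y.
Proof.
move=> XY; rewrite /adjoint; case: xgetP => [Z _ XZ|/(_ Y)/(_ XY)//].
exact: is_adjoint_inj XZ XY.
Qed.

Lemma is_adjoint_sym X Y : is_adjoint dot X Y -> is_adjoint dot Y X.
Proof. by move=> XY x y; rewrite dotC -XY -dotC. Qed.

Lemma bounded_operator_linear X : bounded_operator X -> linear X.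
Proof. by case. Qed.

Lemma bounded_operator_id : bounded_operator (idfun : H -> H).
Proof. by split=> //; exists 1 => x; rewrite mul1r. Qed.

Lemma bounded_operator_lin a X Y : bounded_operator X -> bounded_operator Y ->
  bounded_operator (a \*: X \+ Y).
Proof.
move=> [lX [M XM]] [lY [N YN]]; split=> [b x y /=|].
  by rewrite lX lY !scalerDr !scalerA [b * a]mulrC addrACA.
exists (`|a| * M + N) => x /=; rewrite mulrDl (le_trans (ler_normD _ _))//.
by rewrite lerD// normrZ -mulrA ler_wpM2l.
Qed.

Lemma bounded_operator_comp X Y : bounded_operator X -> bounded_operator Y ->
  bounded_operator (X \o Y).
Proof.
move=> [lX [M XM]] [lY [N YN]]; split=> [b x y /=|]; first by rewrite lY lX.
(* [M] is an arbitrary complex number, so its modulus is taken before the two bounds are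
   multiplied. *)
exists (`|M| * N) => x /=; rewrite (le_trans (XM _))//.
have M0 : 0 <= M * `|Y x| by rewrite (le_trans _ (XM _)).
by rewrite -(ger0_norm M0) normrM normr_id -mulrA ler_wpM2l.
Qed.

Section commutant.
Variable B : set (H -> H).
Hypothesis lB : forall Y, B Y -> linear Y.

Lemma commutant_id : commutant B idfun.
Proof. by split=> //; exact: bounded_operator_id. Qed.

Lemma commutant_lin a X Y : commutant B X -> commutant B Y ->
  commutant B (a \*: X \+ Y).
Proof.
move=> [bX cX] [bY cY]; split; first exact: bounded_operator_lin.
move=> Z BZ; apply/funext => x /=; rewrite lB//.
by have /(congr1 (@^~ x)) /= -> := cX _ BZ; have /(congr1 (@^~ x)) /= -> := cY _ BZ.
Qed.

Lemma commutant_comp X Y : commutant B X -> commutant B Y -> commutant B (X \o Y).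
Proof.
move=> [bX cX] [bY cY]; split; first exact: bounded_operator_comp.
by move=> Z BZ; rewrite -compA cY// compA cX// compA.
Qed.

End commutant.

Lemma commutant_linear B X : commutant B X -> linear X.
Proof. by case=> /bounded_operator_linear. Qed.

Section von_neumann.
Variable A : set (H -> H).
Hypothesis vA : von_neumann_algebra dot A.

(** As a bicommutant, [A] is itself a commutant: its elements are bounded operators, and the closure
    properties of commutants carry over. *)
Lemma vna_linear X : A X -> linear X.
Proof. by rewrite -(vna_bicommutant vA) => /commutant_linear. Qed.

Lemma vna_id : A idfun.
Proof. by rewrite -(vna_bicommutant vA); exact: commutant_id. Qed.

Lemma vna_lin a X Y : A X -> A Y -> A (a \*: X \+ Y).
Proof.
rewrite -(vna_bicommutant vA); apply: commutant_lin => Z.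
exact: commutant_linear.
Qed.

Lemma vna_comp X Y : A X -> A Y -> A (X \o Y).
Proof. by rewrite -(vna_bicommutant vA); exact: commutant_comp. Qed.

Lemma vna_is_adjoint X : A X -> is_adjoint dot X (adjoint dot X).
Proof. by move=> /(vna_adjoint vA)[Y _ XY]; rewrite (adjointP XY). Qed.

Lemma vna_adjoint_mem X : A X -> A (adjoint dot X).
Proof. by move=> /(vna_adjoint vA)[Y AY XY]; rewrite (adjointP XY). Qed.

End von_neumann.

Section vna_algebra.
Variable A : set (H -> H).

(* The proof arguments let the algebra structure below be inferred. *)
Record vna_type (vA : von_neumann_algebra dot A)
  (nz : (idfun : H -> H) <> (fun=> 0)) := VnaType {
  vna_val :> H -> H; vna_valP : `[< A vna_val >] }.

Variables (vA : von_neumann_algebra dot A) (nz : (idfun : H -> H) <> (fun=> 0)).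
Local Notation vna := (vna_type vA nz).

HB.instance Definition _ := [isSub for (@vna_val vA nz)].
HB.instance Definition _ := [Choice of vna by <:].

Definition vna_mem : {pred (H -> H)} := fun X => `[< A X >].

Let vna_mem_submod : submod_closed vna_mem.
Proof.
split=> [|a X Y].
  apply/asboolP; have := vna_lin vA (-1) (vna_id vA) (vna_id vA).
  congr A; apply/funext => x /=; by rewrite scaleN1r addNr.
by move=> /asboolP AX /asboolP AY; apply/asboolP; exact: vna_lin.
Qed.

HB.instance Definition _ := GRing.isSubmodClosed.Build _ _ vna_mem vna_mem_submod.
HB.instance Definition _ :=
  GRing.SubChoice_isSubLmodule.Build _ _ vna_mem vna vna_mem_submod.

Lemma vna_memP (x : vna) : A (vna_val x).
Proof. by apply/asboolP; exact: vna_valP. Qed.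

Let vna_mulP (x y : vna) : `[< A (vna_val x \o vna_val y) >].
Proof. by apply/asboolP/(vna_comp vA); exact: vna_memP. Qed.

Let vna_oneP : `[< A idfun >].
Proof. exact/asboolP/(vna_id vA). Qed.

Definition vna_mul (x y : vna) : vna := VnaType vA nz (vna_mulP x y).
Definition vna_one : vna := VnaType vA nz vna_oneP.

Lemma vna_valD (x y : vna) : vna_val (x + y) = vna_val x \+ vna_val y.
Proof. by []. Qed.

Lemma vna_val_linear (x : vna) : linear (vna_val x).
Proof. by apply: (vna_linear vA); exact: vna_memP. Qed.

Lemma vna_eqP (x y : vna) : vna_val x =1 vna_val y -> x = y.
Proof. by move=> xy; apply/val_inj/funext. Qed.

Let vna_mulA : associative vna_mul.
Proof. by move=> x y z; exact: vna_eqP. Qed.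
Let vna_mul1 : left_id vna_one vna_mul.
Proof. by move=> x; exact: vna_eqP. Qed.
Let vna_mulr1 : right_id vna_one vna_mul.
Proof. by move=> x; exact: vna_eqP. Qed.
Let vna_mulDl : left_distributive vna_mul +%R.
Proof. by move=> x y z; exact: vna_eqP. Qed.
Let vna_mulDr : right_distributive vna_mul +%R.
Proof.
move=> x y z; apply: vna_eqP => h /=; have := vna_val_linear x 1 (y h) (z h).
by rewrite !scale1r.
Qed.
Let vna_one_neq0 : vna_one != 0.
Proof. by apply/eqP => /(congr1 (@vna_val vA nz)); exact: nz. Qed.

HB.instance Definition _ := GRing.Zmodule_isNzRing.Build vna
  vna_mulA vna_mul1 vna_mulr1 vna_mulDl vna_mulDr vna_one_neq0.

Let vna_scaleAl (a : R[i]) (x y : vna) : a *: (x * y) = a *: x * y.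
Proof. exact: vna_eqP. Qed.

HB.instance Definition _ := GRing.Lmodule_isLalgebra.Build R[i] vna vna_scaleAl.

Let vna_scaleAr (a : R[i]) (x y : vna) : a *: (x * y) = x * (a *: y).
Proof.
apply: vna_eqP => h; have := vna_val_linear x a (y h) 0.
have x0 : vna_val x 0 = 0.
  by have := vna_val_linear x (-1) 0 0; rewrite scaler0 addr0 scaleN1r addNr.
by rewrite x0 !addr0; exact: esym.
Qed.

HB.instance Definition _ := GRing.Lalgebra_isAlgebra.Build R[i] vna vna_scaleAr.


Lemma vna_valM (x y : vna) : vna_val (x * y) = vna_val x \o vna_val y.
Proof. by []. Qed.

Lemma vna_valX (x : vna) n : vna_val (x ^+ n) = iter n (vna_val x).
Proof.
elim: n => [|n IH]; first by rewrite expr0.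
by rewrite exprS vna_valM IH.
Qed.

Lemma vna_val_sum I (r : seq I) (f : I -> vna) h :
  vna_val (\sum_(i <- r) f i) h = \sum_(i <- r) vna_val (f i) h.
Proof. by elim/big_rec2: _ => //= i _ x _ <-. Qed.

Let vna_starP (x : vna) : `[< A (adjoint dot (vna_val x)) >].
Proof. by apply/asboolP/(vna_adjoint_mem vA); exact: vna_memP. Qed.

Definition vna_star (x : vna) : vna := VnaType vA nz (vna_starP x).

Lemma vna_starE (x y : vna) : is_adjoint dot (vna_val x) (vna_val y) -> vna_star x = y.
Proof. by move=> xy; apply/val_inj/adjointP. Qed.

Lemma is_adjoint_star (x : vna) : is_adjoint dot (vna_val x) (vna_val (vna_star x)).
Proof. by apply: (vna_is_adjoint vA); exact: vna_memP. Qed.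

Lemma vna_starK : involutive vna_star.
Proof.
by move=> x; apply/vna_starE/is_adjoint_sym; exact: is_adjoint_star.
Qed.

Lemma vna_starD : {morph vna_star : x y / x + y}.
Proof.
move=> x y; apply: vna_starE => g h.
by rewrite !vna_valD /= linearDl linearDr /= !is_adjoint_star.
Qed.

Lemma vna_starZ a (x : vna) : vna_star (a *: x) = a^* *: vna_star x.
Proof.
apply: vna_starE => g h /=.
by rewrite linearZl_LR linearZr_LR /= conjCK is_adjoint_star.
Qed.

Lemma vna_starM x y : vna_star (x * y) = vna_star y * vna_star x.
Proof. by apply: vna_starE => g h; rewrite !vna_valM /= !is_adjoint_star. Qed.

End vna_algebra.
End operators_theory.

Section vna_state.
Context (R : realType) (H : completeNormedModType R[i]).
Context (dot : {dot H for Num.conj}) (A : set (H -> H)) (phi : (H -> H) -> R[i]).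
Hypothesis vA : von_neumann_algebra dot A.
Hypothesis tphi : tracial_state dot A phi.

Lemma tracial_state_nontrivial : (idfun : H -> H) <> (fun=> 0).
Proof.
move=> id0; have := state_linear tphi (-1) (vna_id vA) (vna_id vA).
have -> : -1 \*: idfun \+ idfun = idfun :> (H -> H).
  by rewrite id0; apply/funext => x /=; rewrite scaler0 addr0.
by rewrite (state_unital tphi) mulN1r addNr => /eqP; rewrite oner_eq0.
Qed.

Local Notation vna := (vna_type vA tracial_state_nontrivial).

Definition vna_phi (x : vna) : R[i] := phi (vna_val x).

Let vna_phi_linear : GRing.linear_for *%R vna_phi.
Proof. by move=> a x y; apply: (state_linear tphi); exact: vna_memP. Qed.

HB.instance Definition _ :=
  GRing.isLinear.Build R[i] vna R[i] *%R vna_phi vna_phi_linear.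

Lemma vna_phi1 : vna_phi 1 = 1.
Proof. exact: state_unital tphi. Qed.

Lemma vna_phi_tracial x y : vna_phi (x * y) = vna_phi (y * x).
Proof. by apply: (state_tracial tphi); exact: vna_memP. Qed.

Lemma vna_phi_ge0 x : 0 <= vna_phi (vna_star x * x).
Proof.
by rewrite vna_phi_tracial; apply: (state_positive tphi); exact: vna_memP.
Qed.

(** A positive functional is Hermitian: its values at the squares of [x + a *: 1] are real, and
    [a = 1] with [a = 'i] separate the two unknowns [u] and [v]. *)
Lemma vna_phi_star x : vna_phi (vna_star x) = (vna_phi x)^*.
Proof.
have star1 : vna_star (1 : vna) = 1 by apply: vna_starE => g h.
set u := vna_phi x; set v := vna_phi (vna_star x).
have rx a : a^* * u + a * v = a * u^* + a^* * v^*.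
  have K0 := vna_phi_ge0 x; have := vna_phi_ge0 (x + a *: 1).
  rewrite vna_starD vna_starZ star1 !mulrDr !mulrDl -!scalerAl -!scalerAr.
  rewrite !mul1r !mulr1 !(linearD vna_phi) !(linearZ_LR vna_phi) /= vna_phi1 !mulr1.
  move=> /ger0_real/CrealP; rewrite !rmorphD !rmorphM /= conjCK.
  have /CrealP -> := ger0_real K0; rewrite -/u -/v.
  move/eqP; rewrite -subr_eq0 => /eqP e; apply/eqP; rewrite -subr_eq0; apply/eqP.
  by rewrite -[RHS]oppr0 -[in RHS]e; ring.
have r1 := rx 1; have ri := rx 'i.
rewrite conjC1 !mul1r in r1.
have {}ri : - u + v = u^* - v^*.
  apply: (mulfI (neq0Ci _)); move: ri; rewrite conjCi => ri.
  by rewrite !mulrDr !mulrN -!mulNr ri.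
apply: (@mulfI _ 2); first by rewrite pnatr_eq0.
rewrite -[LHS](_ : u + v + (- u + v) = _); last by ring.
by rewrite r1 ri; ring.
Qed.

Lemma vna_phiX (x : vna) n : vna_phi (x ^+ n) = phi (iter n (vna_val x)).
Proof. by rewrite /vna_phi vna_valX. Qed.

Lemma vna_val_horner (x : vna) (p : {poly R[i]}) :
  vna_val (horner_alg x p) = fun h => \sum_(i < size p) p`_i *: iter i (vna_val x) h.
Proof.
apply/funext => h; rewrite -[in LHS](coefK p) poly_def linear_sum vna_val_sum.
apply: eq_bigr => i _; rewrite (linearZ_LR (horner_alg x)) rmorphXn /= horner_algX.
by rewrite -vna_valX.
Qed.

Lemma vna_opprod (n : nat) (x : nat -> vna) :
  opprod n (fun k => vna_val (x k)) = vna_val (\prod_(k < n) x k).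
Proof.
rewrite /opprod; apply/esym/(big_morph (@vna_val _ _ _ _ vA _)) => //.
Qed.

Lemma vna_free_pair (x : vna) (B : set (H -> H)) :
  free_from phi (vna_val x) B -> free_pair vna_phi x (fun y => B (vna_val y)).
Proof.
move=> fx l l0 sl hl.
rewrite (big_nth (true, 0)) big_mkord.
pose y k := (nth (true, 0 : vna) l k).2.
suff : phi (opprod (size l) (fun k => vna_val (y k))) = 0 by rewrite vna_opprod.
apply: (fx _ (fun k => (nth (true, 0 : vna) l k).1)).
- by rewrite lt0n size_eq0.
- by move=> k kl; apply/eqP; move/(sortedP (true, 0)) : sl => /(_ _ kl).
move=> k kl; have [p0 pin] := hl _ (mem_nth (true, 0) kl); split=> //.
move: pin; rewrite /in_factor /y; case: (nth _ l k).1 => // -[p ->].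
by exists p; exact: vna_val_horner.
Qed.

End vna_state.

(** * Increments of a free Brownian motion *)

(** Every correction term in a Wick word carries the covariance of two adjacent letters. *)
Lemma wick_prod (C : numClosedFieldType) (AA : algType C) (phi : {scalar AA})
    (w : seq AA) : sorted (fun x y => phi (x * y) == 0) w ->
  wick phi w = \prod_(x <- w) x.
Proof.
elim: w => [|x w IH] sw; first by rewrite wick_nil big_nil.
rewrite wick_cons big_cons IH; last exact: path_sorted sw.
case: w sw {IH} => [|y w] /= sw; first by rewrite mulr0 (linear0 phi) scale0r subr0.
by move: sw => /andP[/eqP -> _]; rewrite scale0r subr0.
Qed.

Section brownian.
Local Open Scope complex_scope.
Context (R : realType) (H : completeNormedModType R[i]).
Context (dot : {dot H for Num.conj}) (A : set (H -> H)) (phi : (H -> H) -> R[i]).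
Context (At : R -> set (H -> H)) (S : R -> H -> H).
Hypothesis vA : von_neumann_algebra dot A.
Hypothesis tphi : tracial_state dot A phi.
Hypothesis bS : free_brownian_motion dot A phi At S.
Local Notation vna := (vna_type vA (tracial_state_nontrivial vA tphi)).
Local Notation Phi := (@vna_phi _ _ _ _ _ vA tphi).

(** The default value 0 can only occur at negative times, since [S t] belongs to [A] for
    [0 <= t]. *)
Definition brownian (t : R) : vna := insubd 0 (S t).

Let At_vna t : 0 <= t -> von_neumann_algebra dot (At t).
Proof. by move=> /(fbm_subalgebra bS)[]. Qed.

Lemma brownianE t : 0 <= t -> vna_val (brownian t) = S t.
Proof.
move=> t0; rewrite -[LHS]/(val (insubd _ _)) insubdK//.
apply/asboolP; have [_ +] := fbm_subalgebra bS t0; apply.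
by have [] := fbm_adapted bS t0.
Qed.

Lemma incrementE s t : 0 <= s -> 0 <= t ->
  vna_val (brownian t - brownian s) = S t \- S s.
Proof. by move=> s0 t0; rewrite -!brownianE. Qed.

Lemma brownian0 : brownian 0 = 0.
Proof. by apply: val_inj; rewrite /= brownianE// (fbm_start bS). Qed.

Lemma brownian_star t : 0 <= t -> vna_star (brownian t) = brownian t.
Proof.
move=> t0; apply: vna_starE; rewrite brownianE//.
by have [] := fbm_adapted bS t0.
Qed.

Section increment.
Variables u t : R.
Hypotheses (u0 : 0 <= u) (ut : u < t).
Let Z := brownian t - brownian u.
Let M n := Rintegral (semicircular (t - u)) setT (fun x => x ^+ n).

Let phi_increment n : Phi (Z ^+ n) = (M n)%:C.
Proof.
rewrite vna_phiX incrementE//; last exact: le_trans (ltW ut).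
by have [_ ->] := fbm_increment bS u0 ut n.
Qed.

Let tu : 0 < t - u. Proof. by rewrite subr_gt0. Qed.

Lemma increment_moments n : n.+3%:R * Phi (Z ^+ n.+1) =
  4 * Phi (Z * Z) * n%:R * Phi (Z ^+ n.-1).
Proof.
have M0 : M 0 = 1.
  apply: complexI; rewrite -phi_increment expr0 vna_phi1.
  by rewrite rmorph1.
(* The recurrence at [k = 1] gives the variance from the mass [M 0], which is [phi 1 = 1]; the
   semicircle is never integrated explicitly. *)
have M2 : M 2 = t - u.
  apply: (@mulfI _ 4%:R); first by rewrite pnatr_eq0.
  by have := semicircular_moment_rec 1 tu; rewrite -/(M _) /= -/(M 0) M0 !mulr1.
rewrite -expr2 !phi_increment M2.
have := congr1 (real_complex R) (semicircular_moment_rec n tu).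
by rewrite -/(M _) -/(M _) !rmorphM /= !rmorph_nat.
Qed.

Lemma phi_wick_increment n : (0 < n)%N -> Phi (wick Phi (nseq n Z)) = 0.
Proof.
move=> n0; apply: (@phi_wick_semicircular _ _ Phi Z) => // k.
exact: increment_moments.
Qed.

Lemma increment_free : free_pair Phi Z (fun x => At u (vna_val x)).
Proof.
apply: vna_free_pair; rewrite incrementE//; last exact: le_trans (ltW ut).
exact: (fbm_free bS).
Qed.

End increment.

Definition is_increment (x : vna) :=
  exists s t, [/\ 0 <= s, 0 <= t & x = brownian t - brownian s].

Let At_le u t x : 0 <= u -> u < t -> At u (vna_val x) -> At t (vna_val (x : vna)).
Proof. by move=> u0 ut; apply: (fbm_filtration bS). Qed.

Lemma increments_semicircular (w : seq vna) : w != [::] -> letters is_increment w ->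
  Phi (wick Phi w) = 0.
Proof.
apply: (@phi_wick_increments R _ vna Phi
  (fun t (x : vna) => At t (vna_val x)) brownian) => //.
- by move=> t t0; exact (vna_id (At_vna t0)).
- by move=> t a x y t0 Ax Ay; exact (vna_lin (At_vna t0) a Ax Ay).
- by move=> t x y t0 Ax Ay; exact (vna_comp (At_vna t0) Ax Ay).
- by move=> t t0; rewrite brownianE//; have [] := fbm_adapted bS t0.
- exact: brownian0.
- exact: increment_free.
- by move=> u t n u0 ut; exact: phi_wick_increment.
Qed.

Lemma increment_star x : is_increment x -> vna_star x = x.
Proof.
move=> [s [t [s0 t0 ->]]].
by rewrite vna_starD -scaleN1r vna_starZ rmorphN1 !brownian_star.
Qed.

Let phi_increment0 u t : 0 <= u -> u < t -> Phi (brownian t - brownian u) = 0.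
Proof.
by move=> u0 ut; have := phi_wick_increment u0 ut (isT : 0 < 1)%N; rewrite wick1.
Qed.

Lemma phi_disjoint_increments a b c d : 0 <= a -> a < b -> b <= c -> c < d ->
  Phi ((brownian b - brownian a) * (brownian d - brownian c)) = 0.
Proof.
move=> a0 ab bc cd; have b0 := le_trans a0 (ltW ab); have c0 := le_trans b0 bc.
have := increment_free c0 cd
  (l := [:: (false, brownian b - brownian a); (true, brownian d - brownian c)]).
rewrite big_cons big_seq1; apply => //.
have Ac s : 0 <= s -> s <= c -> At c (S s).
  move=> s0; rewrite le_eqVlt => /predU1P[->|sc].
    by have [] := fbm_adapted bS c0.
  by apply: (fbm_filtration bS s0 sc); have [] := fbm_adapted bS s0.
move=> p /[!inE] /orP[] /eqP -> /=; split; try exact: phi_increment0.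
  suff : At c (S b \- S a) by rewrite -incrementE.
  have -> : S b \- S a = -1 \*: S a \+ S b.
    by apply/funext => h /=; rewrite scaleN1r addrC.
  exact (vna_lin (At_vna c0) (-1) (Ac a a0 (le_trans (ltW ab) bc)) (Ac b b0 bc)).
by exists 'X; rewrite horner_algX.
Qed.

Definition box_word q (J : q.-tuple (R * R)) : seq vna :=
  [seq brownian p.2 - brownian p.1 | p <- J].

Lemma box_word_increments q (J : q.-tuple (R * R)) : offdiagonal_box J ->
  letters is_increment (box_word J).
Proof.
move=> [J0 _] x /mapP[p /tnthP[i ->] ->].
have /andP[a0 ab] := J0 i; exists (tnth J i).1, (tnth J i).2.
by split=> //; exact: le_trans (ltW ab).
Qed.

Lemma disjoint_itv (a b c d : R) : a < b -> c < d ->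
  `]a, b[ `&` `]c, d[ = set0 -> (b <= c) || (d <= a).
Proof.
move=> ab cd; apply: contraPT; rewrite negb_or -!ltNge => /andP[cb ad].
have Mm : Num.max a c < Num.min b d by rewrite gt_max !lt_min ab cb ad cd.
have [] := midf_lt Mm; rewrite gt_max lt_min => /andP[am cm] /andP[mb md] J.
have : (`]a, b[ `&` `]c, d[) ((Num.max a c + Num.min b d) / 2).
  by split; rewrite /= in_itv /= ?am ?cm.
by rewrite J.
Qed.

(** Neighboring sides of the box are disjoint, so their increments are uncorrelated by freeness and
    the Wick word is the plain product. Traciality covers the case where the later increment stands
    on the left. *)
Lemma wick_box_word q (J : q.-tuple (R * R)) : offdiagonal_box J ->
  vna_val (wick Phi (box_word J)) = box_integral S J.
Proof.
move=> [J0 J1]; rewrite wick_prod; last first.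
  apply/(sortedP 0) => i; rewrite size_map size_tuple => iq.
  pose j1 := Ordinal (ltnW iq); pose j2 := Ordinal iq.
  rewrite !(nth_map (0, 0)) ?size_tuple//; last exact: ltnW.
  rewrite -(tnth_nth _ J j1) -(tnth_nth _ J j2); apply/eqP.
  have /andP[a0 ab] := J0 j1; have /andP[c0 cd] := J0 j2.
  have /orP[bc|da] :
      ((tnth J j1).2 <= (tnth J j2).1) || ((tnth J j2).2 <= (tnth J j1).1).
    by apply: disjoint_itv => //; apply: J1; rewrite -val_eqE /= neq_ltn ltnSn.
    exact: phi_disjoint_increments.
  by apply: etrans (vna_phi_tracial _ _) _; exact: phi_disjoint_increments.
rewrite big_map big_tuple /box_integral.
rewrite (big_morph (@vna_val _ _ _ _ vA _) (id1 := idfun) (op1 := comp))//.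
apply: eq_bigr => i _; have /andP[a0 ab] := J0 i.
by rewrite incrementE//; exact: le_trans (ltW ab).
Qed.

Definition step_chaos q (s : step R q) : seq (R[i] * seq vna) :=
  [seq (p.1, box_word p.2) | p <- s].

Lemma homogeneous_step_chaos q (s : step R q) :
  (forall p, p \in s -> offdiagonal_box p.2) ->
  homogeneous is_increment q (step_chaos s).
Proof.
move=> hs p /mapP[r /hs hr ->] /=; rewrite size_map size_tuple; split=> //.
exact: box_word_increments.
Qed.

Lemma step_chaosE q (s : step R q) :
  (forall p, p \in s -> offdiagonal_box p.2) ->
  vna_val (chaos_elt Phi (step_chaos s)) = step_integral S s.
Proof.
move=> hs; apply/funext => h; rewrite /chaos_elt big_map vna_val_sum.
apply: eq_big_seq => p /hs hp; rewrite -wick_box_word//.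
Qed.

End brownian.

Theorem proposition1p5 (R : realType) (H : completeNormedModType R[i])
    (dot : {dot H for Num.conj}) (A : set (H -> H)) (phi : (H -> H) -> R[i])
    (At : R -> set (H -> H)) (S : R -> H -> H) (q : nat) (F : H -> H) :
  hilbert_norm dot ->
  von_neumann_algebra dot A ->
  tracial_state dot A phi ->
  free_brownian_motion dot A phi At S ->
  (4 <= q)%N -> ~~ odd q ->
  wigner_chaos dot A phi S q F ->
  selfadjoint dot F ->
  F <> (fun=> 0) ->
  ~ exists lambda : R, 0 < lambda /\ has_law phi F (centered_free_poisson lambda).
Proof.
move=> _ vA tphi bS q4 _ [f _ [AF [s [hs _ sF]]]] saF _ [lambda [l0 lawF]].
pose vna := vna_type vA (tracial_state_nontrivial vA tphi).
pose Phi := @vna_phi _ _ _ _ _ vA tphi.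
pose F' : vna := VnaType vA _ (asboolT AF).
pose s' n : seq (R[i] * seq vna) := step_chaos S vA tphi (s n).
pose P : vna -> Prop := is_increment S (vA := vA) (tphi := tphi).
pose star : vna -> vna := fun x => vna_star x.
have hs' n : homogeneous P q (s' n).
  by apply: homogeneous_step_chaos => p; exact: hs.
have starK : involutive star by exact: vna_starK.
have starD : {morph star : x y / x + y} by exact: vna_starD.
have starZ a x : star (a *: x) = a^* *: star x by exact: vna_starZ.
have starM x y : star (x * y) = star y * star x by exact: vna_starM.
have phi_star (x : vna) : Phi (star x) = (Phi x)^* by exact: vna_phi_star.
have phi_ge0 (x : vna) : 0 <= Phi (star x * x) by exact: vna_phi_ge0.
have phiC (x y : vna) : Phi (x * y) = Phi (y * x) by exact: vna_phi_tracial.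
have phi1 : Phi 1 = 1 by exact: vna_phi1.
have P_star (x : vna) : P x -> star x = x by exact: (increment_star bS).
have P_wick (w : seq vna) : w != [::] -> letters P w -> Phi (wick Phi w) = 0.
  exact: (increments_semicircular bS).
have sF' : cvg_L2 Phi star (fun n => chaos_elt Phi (s' n)) F'.
  have E n : vna_val (F' - chaos_elt Phi (s' n)) = F \- step_integral S (s n).
    by rewrite -(step_chaosE vA tphi bS (hs n)).
  move: sF; apply: cvg_trans; apply: near_eq_cvg; near=> n.
  by rewrite -E.
(* An element of positive order is centered; this provides the zero mean that normalizes the free
   Poisson integrals. *)
have F1 : Phi F' = 0.
  have := chaos_limit_mean starK starD starZ starM phi_star phi_ge0 phiC phi1
    P_star P_wick hs' sF'.
  by apply; exact: ltn_trans q4.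
pose c m := Rintegral (centered_free_poisson lambda) setT (fun x => x ^+ m).
have phiF m : Phi (F' ^+ m) = (c m)%:C%C.
  have -> : Phi (F' ^+ m) = phi (iter m F) by exact: vna_phiX.
  by have [_ ->] := lawF m.
have c0 : c 0%N = 1.
  by apply: complexI; rewrite -phiF expr0 phi1 rmorph1.
have c1 : c 1%N = 0.
  by apply: complexI; rewrite -phiF expr1 F1 rmorph0.
have [c2 c3 c4] := centered_free_poisson_moments l0 (fun m => (lawF m).1) c0 c1.
have F'sa : star F' = F' by apply: vna_starE.
have m4 : Phi (F' ^+ 4) = lambda%:C%C + 2 * lambda%:C%C ^+ 2.
  by rewrite phiF /c c4 rmorphD rmorphM rmorphXn /= rmorph_nat.
have := chaos_moments_eq0 starK starD starZ starM phi_star phi_ge0 phiC phi1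
  P_star P_wick hs' sF' (ltn_trans (isT : 2 < 3)%N q4) F'sa
  (etrans (phiF 2) (congr1 (real_complex R) c2))
  (etrans (phiF 3) (congr1 (real_complex R) c3)) m4.
by move=> /eqP; rewrite fmorph_eq0 gt_eqF.
Unshelve. all: by end_near. Qed.
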